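(* Let $t\ge1$, let $d_1,\dots,d_t$ be positive integers and $h_1,\dots,h_t$ nonnegative integers, and put $d_0=0$, $D_i=d_1+\cdots+d_i$, $H_i=h_1+\cdots+h_i$, $n=D_t$. Let $B=B(h_1,d_1;\dots;h_t,d_t)$ be the Ferrers board with $n$ columns whose first $d_1$ columns have height $H_1$, next $d_2$ columns have height $H_2$, ..., last $d_t$ columns have height $H_t$; here $H_t$ may be greater than $D_t=n$ (so $B$ may be inadmissible). For $0\le k\le n$ set $$L_k(B)=\mathrm{Area}(B)+n(n-k)-\sum_{i=1}^t D_id_i .$$ Then $T_k(B)$ is either zero or symmetric with darga $L_k(B)$. In addition, if either 1) $d_{i-1}+d_i\ge h_i$ for $1\le i\le t$, or 2) $D_i\ge H_i$ for $1\le i\le t$, then $$\frac{T_k(B)}{\prod_{i=1}^t[d_i]!}\ \text{ is } zsu(L_k(B)).$$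
   Context: The board $B$ consists, in each column, of the top $c$ squares, where $c$ is the height of that column (rows numbered from the top, columns from the left); rows are unlimited in number, so heights may exceed $n$. $\mathrm{Area}(B)=\sum_i d_iH_i$ is the number of squares of $B$. Write $[m]=(1-q^m)/(1-q)$ and $[k]!=\prod_{i=1}^k[i]$. Rooks are non-attacking if no two share a row or a column. The $q$-rook polynomial is $R_k(B)=\sum_C q^{\mathrm{inv}(C,B)}$, the sum over all placements $C$ of $k$ non-attacking rooks on squares of $B$, where $\mathrm{inv}(C,B)$ is the number of squares of $B$ that do not contain a rook, are not above a rook (in its column), and are not to the right of a rook (in its row). The $T_k(B)$ are defined by $$\sum_{k=0}^n [k]!\,R_{n-k}(B)\prod_{i=k+1}^n (x-q^i)=\sum_{k=0}^n T_k(B)\,x^k .$$ For a polynomial $f(q)=\sum_{j=M}^N a_jq^j$ with $a_M\ne0$, $a_N\ne0$: $f$ is symmetric if $a_{M+k}=a_{N-k}$ for $0\le k\le N-M$; $f$ is unimodal if there is $p$ with $M\le p\le N$ and $a_M\le a_{M+1}\le\cdots\le a_p\ge a_{p+1}\ge\cdots\ge a_N$; and $\mathrm{darga}(f)=M+N$. A polynomial $f$ is $zsu(d)$ if either $f$ is identically zero, or $f\in\mathbb N[q]$ (nonnegative integer coefficients) and $f$ is symmetric and unimodal with $\mathrm{darga}(f)=d$.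
   Formalization: The first claim is false as stated (t=1, d_1=2, h_1=0: T_0=1+q has darga 1, but L_0=0); it is proved that T_k(B) is zero or symmetric with darga L_k(B)+Σ C(d_i,2), and that T_k(B)/∏[d_i]! is a polynomial that is zero or symmetric with darga L_k(B). *)

(* Defs.v *)
From mathcomp Require Import all_boot all_order all_algebra.

Set Implicit Arguments.
Unset Strict Implicit.
Unset Printing Implicit Defensive.

Import Order.TTheory GRing.Theory Num.Theory.
Local Open Scope ring_scope.

(* In {poly int} the variable 'X is q; in {poly {poly int}} the outer variable
   'X is x and ('X)%:P is q. *)

Definition qint (m : nat) : {poly int} := \sum_(i < m) 'X^i.

Lemma qintE (m : nat) : (1 - 'X) * qint m = 1 - 'X^m.
Proof.
rewrite -[1 - 'X]opprB mulNr /qint -[in 1 - 'X^m](opprB ('X^m) 1).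
by congr (- _); rewrite subrX1.
Qed.

Definition qfact (k : nat) : {poly int} := \prod_(1 <= i < k.+1) qint i.

(* A square (r, c) has row r, numbered from the top, and column c, numbered
   from the left, both from 0. The bound m on rows only has to be at least the
   height of every column. *)
Section QRook.

Variables m n : nat.
Implicit Types (B C : {set 'I_m * 'I_n}).

Definition nonattacking C : bool :=
  [forall s in C, forall u in C, (s != u) ==> (s.1 != u.1) && (s.2 != u.2)].

Definition placements B (k : nat) : {set {set 'I_m * 'I_n}} :=
  [set C : {set 'I_m * 'I_n} | [&& C \subset B, #|C| == k & nonattacking C]].

Definition above_rook C (s : 'I_m * 'I_n) : bool :=
  [exists u in C, (s.2 == u.2) && (s.1 < u.1)%N].

Definition right_of_rook C (s : 'I_m * 'I_n) : bool :=
  [exists u in C, (s.1 == u.1) && (u.2 < s.2)%N].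

Definition inv B C : nat :=
  #|[set s in B | [&& s \notin C, ~~ above_rook C s & ~~ right_of_rook C s]]|.

Definition qrook B (k : nat) : {poly int} :=
  \sum_(C in placements B k) 'X^(inv B C).

Definition qhit_gen B : {poly {poly int}} :=
  \sum_(k < n.+1)
     (qfact k * qrook B (n - k)%N)%:P * \prod_(k.+1 <= i < n.+1) ('X - ('X^i)%:P).

(* T_k(B), the coefficient of x^k; qhit_gen B has degree at most n in x. *)
Definition qhit B (k : nat) : {poly int} := (qhit_gen B)`_k.

End QRook.

(* D_i = psum d i and H_i = psum h i. *)
Definition psum (a : nat -> nat) (i : nat) : nat := (\sum_(1 <= j < i.+1) a j)%N.

Definition col_heights (t : nat) (h d : nat -> nat) : seq nat :=
  flatten [seq nseq (d i) (psum h i) | i <- index_iota 1 t.+1].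

(* B(h_1,d_1; ...; h_t,d_t); the rows are bounded by the largest height H_t. *)
Definition ferrers (t : nat) (h d : nat -> nat) :
    {set 'I_(psum h t) * 'I_(psum d t)} :=
  [set s : 'I_(psum h t) * 'I_(psum d t) |
     (s.1 < nth 0 (col_heights t h d) s.2)%N].

(* L_k(B); it can be negative. *)
Definition Ldarga (t : nat) (h d : nat -> nat) (k : nat) : int :=
  let n := psum d t in
  #|ferrers t h d|%:Z + (n * (n - k))%N%:Z
    - (\sum_(1 <= i < t.+1) psum d i * d i)%N%:Z.

(* For f != 0 these are the indices M and N of the first and of the last
   nonzero coefficient. *)
Definition lowdeg (f : {poly int}) : nat := find (fun a : int => a != 0) f.
Definition topdeg (f : {poly int}) : nat := (size f).-1.

Definition darga (f : {poly int}) : nat := (lowdeg f + topdeg f)%N.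

Definition symmetric_poly (f : {poly int}) : Prop :=
  forall k : nat, (k <= topdeg f - lowdeg f)%N ->
    f`_(lowdeg f + k)%N = f`_(topdeg f - k)%N.

Definition unimodal_poly (f : {poly int}) : Prop :=
  exists p : nat,
    [/\ (lowdeg f <= p <= topdeg f)%N,
        forall j : nat, (lowdeg f <= j < p)%N -> f`_j <= f`_j.+1
      & forall j : nat, (p <= j < topdeg f)%N -> f`_j.+1 <= f`_j].

Definition zero_or_symmetric (l : int) (f : {poly int}) : Prop :=
  f = 0 \/ (symmetric_poly f /\ (darga f)%:Z = l).

Definition zsu (l : int) (f : {poly int}) : Prop :=
  f = 0 \/
  [/\ forall j : nat, 0 <= f`_j, symmetric_poly f, unimodal_poly f
    & (darga f)%:Z = l].

(* Main.v *)
(* Let [b_i] be the height of column [i], counted from 0. Filling the board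
   column by column gives the q-factorization of Garsia and Remmel,
   [sum_k R_(n-k) [j][j-1]...[j-k+1] = prod_i [j + b_i - i]], so that
   [T_(n-m)] is the coefficient of [x^m] in
     [prod_(i <= n) (1 - x q^i) * sum_j x^j prod_i [j + b_i - i]].
   Grouping equal columns, the inner product is [prod_i [d_i]!] times
   [A_j = prod_i qbinom (j + H_i - D_(i-1)) d_i], which gives the divisibility.
   Expanding the product by the q-binomial theorem writes the quotient as an
   alternating sum of products of q-binomials, all with the same darga.
   For positivity, add the blocks one at a time: by a q-analogue of Nanjundiah's
   identity the new quotients are combinations of the old ones whose
   coefficients are powers of q times two q-binomials, with nonnegative upper
   arguments under either hypothesis. Symmetric unimodal polynomials of given
   darga are the cone over the [q^i [m]], which is stable under products by the
   Clebsch-Gordan rule, and q-binomials are unimodal because sl2 acts on the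
   exterior powers of its irreducible representations. *)
Require Import Defs.
From mathcomp Require Import all_boot all_order all_fingroup all_algebra.
From mathcomp Require Import zify ring.

Set Implicit Arguments.
Unset Strict Implicit.
Unset Printing Implicit Defensive.

Import Order.TTheory GRing.Theory Num.Theory.
Local Open Scope ring_scope.

(** * q-integers and q-binomials *)

Lemma qint0 : qint 0 = 0. Proof. by rewrite /qint big_ord0. Qed.

Lemma qint1 : qint 1 = 1. Proof. by rewrite /qint big_ord1. Qed.

Lemma qintD (m n : nat) : qint (m + n) = qint m + 'X^m * qint n.
Proof.
by rewrite /qint big_split_ord mulr_sumr; congr (_ + _); apply: eq_bigr => i _; rewrite -exprD.
Qed.

Lemma coef_qint (m j : nat) : (qint m)`_j = (j < m)%N%:R.
Proof.
rewrite /qint coef_sum; under eq_bigr do rewrite coefXn.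
case: ltnP => [ltjm|lemj].
  rewrite (bigD1 (Ordinal ltjm)) //= eqxx big1 ?addr0 // => i.
  by rewrite -val_eqE /= eq_sym => /negPf->.
by rewrite big1 // => i _; case: eqP => // E; move: (ltn_ord i); rewrite -E ltnNge lemj.
Qed.

Lemma qint_eq0 (m : nat) : (qint m == 0) = (m == 0)%N.
Proof.
case: m => [|m]; first by rewrite qint0 !eqxx.
apply/eqP => /(congr1 (fun p : {poly int} => p`_0)).
by rewrite coef_qint coef0.
Qed.

Lemma qfactS (k : nat) : qfact k.+1 = qfact k * qint k.+1.
Proof. by rewrite /qfact big_nat_recr. Qed.

Lemma qfact0 : qfact 0 = 1. Proof. by rewrite /qfact big_geq. Qed.

Lemma qfact_neq0 (k : nat) : qfact k != 0.
Proof.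
elim: k => [|k IH]; first by rewrite qfact0 oner_neq0.
by rewrite qfactS mulf_neq0 // qint_eq0.
Qed.

(* Truncated subtraction is harmless: the product then has a factor [qint 0]. *)
Definition qff (n k : nat) : {poly int} := \prod_(i < k) qint (n - i).

Lemma qff0 (n : nat) : qff n 0 = 1. Proof. by rewrite /qff big_ord0. Qed.

Lemma qffSr (n k : nat) : qff n k.+1 = qff n k * qint (n - k).
Proof. by rewrite /qff big_ord_recr. Qed.

Lemma qffSS (n k : nat) : qff n.+1 k.+1 = qint n.+1 * qff n k.
Proof. by rewrite /qff big_ord_recl. Qed.

Lemma qff_small (n k : nat) : (n < k)%N -> qff n k = 0.
Proof.
by move=> ltnk; rewrite /qff (bigD1 (Ordinal ltnk)) //= subnn qint0 mul0r.
Qed.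

Lemma qff_add (n a b : nat) : qff n (a + b) = qff n a * qff (n - a) b.
Proof.
rewrite /qff big_split_ord; congr (_ * _); apply: eq_bigr => i _ /=.
by rewrite subnDA.
Qed.

Lemma qff_nn (n : nat) : qff n n = qfact n.
Proof. by elim: n => [|n IH]; rewrite ?qff0 ?qfact0 // qffSS IH qfactS mulrC. Qed.

(** Taking Pascal's rule as definition avoids division in [{poly int}]; [qbinom_fact] recovers the
    quotient of q-factorials. *)
Fixpoint qbinom (n k : nat) : {poly int} :=
  match n, k return {poly int} with
  | _, 0%N => 1
  | 0%N, _.+1 => 0
  | n'.+1, k'.+1 => 'X^k * qbinom n' k + qbinom n' k'
  end.

Arguments qbinom : simpl never.

Lemma qbinom0 (n : nat) : qbinom n 0 = 1. Proof. by case: n. Qed.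

Lemma qbinomS (n k : nat) :
  qbinom n.+1 k.+1 = 'X^(k.+1) * qbinom n k.+1 + qbinom n k.
Proof. by []. Qed.

Lemma qbinom_fact (n k : nat) : qbinom n k * qfact k = qff n k.
Proof.
elim: n k => [|n IH] [|k]; rewrite ?qbinom0 ?qfact0 ?qff0 ?mul1r //.
  by rewrite mul0r qff_small.
rewrite qbinomS mulrDl -mulrA IH qfactS mulrA IH qffSr qffSS.
case: (leqP k n) => [lekn|ltnk]; last by rewrite !qff_small // !(mul0r, mulr0) addr0.
rewrite -[in qint n.+1](subnKC lekn) -addSn qintD; ring.
Qed.

Lemma qbinom_small (n k : nat) : (n < k)%N -> qbinom n k = 0.
Proof.
move=> ltnk; have /eqP := qbinom_fact n k.
by rewrite qff_small // mulf_eq0 (negPf (qfact_neq0 _)) orbF => /eqP.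
Qed.

Lemma qbinomnn (n : nat) : qbinom n n = 1.
Proof.
apply: (mulIf (qfact_neq0 n)); by rewrite qbinom_fact qff_nn mul1r.
Qed.

Lemma qbinomS' (n k : nat) :
  qbinom n.+1 k.+1 = qbinom n k.+1 + 'X^(n - k) * qbinom n k.
Proof.
apply: (mulIf (qfact_neq0 k.+1)); rewrite qbinom_fact mulrDl qbinom_fact -mulrA.
rewrite qfactS (mulrA (qbinom _ _)). rewrite qbinom_fact qffSS qffSr.
case: (leqP k n) => [lekn|ltnk]; last by rewrite !qff_small // !(mul0r, mulr0) addr0.
rewrite -[in qint n.+1](subnK lekn) -addnS qintD; ring.
Qed.

(** Multiplied by [[a]! [b]!], both sides become the falling product [qff (j + a) (a + b)]. *)
Lemma qbinom_mul (j a b : nat) :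
  qbinom (j + a) a * qbinom j b = qbinom (a + b) b * qbinom (j + a) (a + b).
Proof.
apply: (mulIf (qfact_neq0 a)); apply: (mulIf (qfact_neq0 b)).
have -> : qbinom (j + a) a * qbinom j b * qfact a * qfact b
        = (qbinom (j + a) a * qfact a) * (qbinom j b * qfact b) by ring.
have -> : qbinom (a + b) b * qbinom (j + a) (a + b) * qfact a * qfact b
        = (qbinom (a + b) b * qfact b) * qfact a * qbinom (j + a) (a + b) by ring.
rewrite !qbinom_fact.
have -> : qff (a + b) b * qfact a = qfact (a + b).
  by rewrite (addnC a) -(qff_nn (b + a)) qff_add addKn qff_nn.
by rewrite mulrC [RHS]mulrC qbinom_fact qff_add addnK mulrC.
Qed.

(** * Symmetric unimodal polynomials *)

(* The generator [q^i (1 + ... + q^(m-1))] has darga [l]. The span is a cone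
   for [s = false] and a group for [s = true]; these are the unimodal and the
   merely symmetric polynomials. *)
Inductive qspan (s : bool) (l : int) : {poly int} -> Prop :=
| qspan0 : qspan s l 0
| qspan_int (i m : nat) : (i.*2 + m)%N%:Z = l + 1 -> qspan s l ('X^i * qint m)
| qspanD (f g : {poly int}) : qspan s l f -> qspan s l g -> qspan s l (f + g)
| qspanN (f : {poly int}) : s -> qspan s l f -> qspan s l (- f).

Lemma qspanW (s : bool) (l : int) (f : {poly int}) : qspan false l f -> qspan s l f.
Proof.
elim=> [|i m E|f1 f2 _ IH1 _ IH2|f1 //].
- exact: qspan0.
- exact: qspan_int.
- exact: qspanD.
Qed.

Lemma qspan_sum (s : bool) (l : int) (I : finType) (P : pred I) (F : I -> {poly int}) :
  (forall i, P i -> qspan s l (F i)) -> qspan s l (\sum_(i | P i) F i).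
Proof.
by move=> H; apply: big_ind => //; [apply: qspan0 | apply: qspanD].
Qed.

Lemma qspanXM (s : bool) (l : int) (i : nat) (f : {poly int}) :
  qspan s l f -> qspan s (l + i.*2%:Z) ('X^i * f).
Proof.
elim=> [|j m E|f1 f2 _ IH1 _ IH2|f1 Hs _ IH].
- by rewrite mulr0; apply: qspan0.
- by rewrite mulrA -exprD; apply: qspan_int; lia.
- by rewrite mulrDr; apply: qspanD.
- by rewrite mulrN; apply: qspanN.
Qed.

Lemma qspan_qint (s : bool) (m : nat) : qspan s (m%:Z - 1) (qint m).
Proof.
by rewrite -[qint m]mul1r -(expr0 'X); apply: qspan_int; rewrite subrK.
Qed.

(* Clebsch-Gordan, one summand at a time. *)
Lemma qint_mul (m n : nat) : qint m.+1 * qint n.+1 = qint (m + n).+1 + 'X * (qint m * qint n).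
Proof.
rewrite -addnS qintD -[in LHS](addn1 m) -[n.+1]add1n !qintD qint1 expr1. ring.
Qed.

Lemma qspan_int_mul (s : bool) (m n : nat) :
  (0 < m)%N -> (0 < n)%N -> qspan s ((m + n)%N%:Z - 2) (qint m * qint n).
Proof.
elim: m n => [//|m IH] [//|n] _ _; rewrite qint_mul; apply: qspanD.
  have := qspan_qint s (m + n).+1; congr (qspan _ _ _); lia.
case: m IH => [|m] IH; first by rewrite qint0 mul0r mulr0; apply: qspan0.
case: n => [|n]; first by rewrite qint0 mulr0 mulr0; apply: qspan0.
have := @qspanXM s _ 1 _ (IH n.+1 isT isT); congr (qspan _ _ _); lia.
Qed.

Lemma qspanM (s : bool) (l1 l2 : int) (f g : {poly int}) :
  qspan s l1 f -> qspan s l2 g -> qspan s (l1 + l2) (f * g).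
Proof.
move=> Hf Hg; elim: Hf => [|i m E|f1 f2 _ IH1 _ IH2|f1 Hs _ IH].
- by rewrite mul0r; apply: qspan0.
- elim: Hg => [|j n E'|g1 g2 _ IH1 _ IH2|g1 Hs _ IH].
  + by rewrite mulr0; apply: qspan0.
  + case: m E => [|m] E; first by rewrite qint0 mulr0 mul0r; apply: qspan0.
    case: n E' => [|n] E'; first by rewrite qint0 !mulr0; apply: qspan0.
    have -> : 'X^i * qint m.+1 * ('X^j * qint n.+1)
            = 'X^(i + j) * (qint m.+1 * qint n.+1) by rewrite exprD mulrACA.
    have := qspanXM (i + j) (@qspan_int_mul s m.+1 n.+1 isT isT).
    congr (qspan _ _ _); lia.
  + by rewrite mulrDr; apply: qspanD.
  + by rewrite mulrN; apply: qspanN.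
- by rewrite mulrDl; apply: qspanD.
- by rewrite mulNr; apply: qspanN.
Qed.

Lemma qspan1 (s : bool) : qspan s 0 1.
Proof. by have := qspan_qint s 1; rewrite qint1. Qed.

Lemma qspan_qfact (s : bool) (m : nat) : qspan s ('C(m, 2))%:Z (qfact m).
Proof.
elim: m => [|m IH]; first by rewrite qfact0; apply: qspan1.
rewrite qfactS binS bin1.
have := qspanM IH (qspan_qint s m.+1); congr (qspan _ _ _); lia.
Qed.

Lemma coef_qspan_gen (i m j : nat) :
  ('X^i * qint m : {poly int})`_j = ((i <= j) && (j < i + m))%N%:R.
Proof.
rewrite coefXnM coef_qint; case: ltnP => //= leij.
by rewrite ltn_subLR.
Qed.

Lemma qspan_sym (s : bool) (l : int) (f : {poly int}) (i j : nat) :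
  qspan s l f -> (i + j)%N%:Z = l -> f`_i = f`_j.
Proof.
move=> Hf Hij; elim: Hf => [|a m E|f1 f2 _ IH1 _ IH2|f1 Hs _ IH].
- by rewrite !coef0.
- by rewrite !coef_qspan_gen; congr (_ %:R); congr nat_of_bool; lia.
- by rewrite !coefD IH1 IH2.
- by rewrite !coefN IH.
Qed.

Lemma qspan_deg (s : bool) (l : int) (f : {poly int}) (i : nat) :
  qspan s l f -> l < i%:Z -> f`_i = 0.
Proof.
move=> Hf Hi; elim: Hf => [|a m E|f1 f2 _ IH1 _ IH2|f1 Hs _ IH].
- by rewrite !coef0.
- rewrite !coef_qspan_gen; have -> // : ((a <= i) && (i < a + m))%N = false by lia.
- by rewrite !coefD IH1 IH2.
- by rewrite !coefN IH oppr0.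
Qed.

Lemma qspan_ge0 (l : int) (f : {poly int}) (i : nat) : qspan false l f -> 0 <= f`_i.
Proof.
elim=> [|a m E|f1 f2 _ IH1 _ IH2|f1 //].
- by rewrite !coef0.
- by rewrite !coef_qspan_gen.
- by rewrite !coefD addr_ge0.
Qed.

Lemma qspan_incr (l : int) (f : {poly int}) (i : nat) :
  qspan false l f -> (i.*2.+1)%:Z <= l -> f`_i <= f`_i.+1.
Proof.
move=> Hf Hi; elim: Hf => [|a m E|f1 f2 _ IH1 _ IH2|f1 //].
- by rewrite !coef0.
- by rewrite !coef_qspan_gen ler_nat; lia.
- by rewrite !coefD lerD.
Qed.

(** * From spans to darga, symmetry and unimodality *)

Lemma lowdegP (f : {poly int}) :
  f != 0 -> f`_(lowdeg f) != 0 /\ (lowdeg f <= topdeg f)%N.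
Proof.
move=> f0; have Hh : has (fun a : int => a != 0) f.
  apply/hasP; exists (lead_coef f); last by rewrite lead_coef_eq0.
  by rewrite /lead_coef mem_nth // prednK ?size_poly_gt0.
split; first exact: (nth_find 0 Hh).
by move: Hh; rewrite has_find /lowdeg /topdeg; case: (size f).
Qed.

Lemma lowdeg_min (f : {poly int}) (i : nat) : f`_i != 0 -> (lowdeg f <= i)%N.
Proof.
rewrite leqNgt; apply: contra => lti.
by have /negbT := before_find 0 lti; rewrite negbK.
Qed.

Lemma topdeg_max (f : {poly int}) (i : nat) : f`_i != 0 -> (i <= topdeg f)%N.
Proof.
rewrite leqNgt; apply: contra => lti; rewrite nth_default //.
by move: lti; rewrite /topdeg; case: (size f).
Qed.

(** The coefficients vanish above [l] and are invariant under [i -> l - i], so this reflection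
    exchanges the first and the last nonzero one. *)
Lemma qspan_darga (s : bool) (l : int) (f : {poly int}) :
  f != 0 -> qspan s l f -> (darga f)%:Z = l.
Proof.
move=> f0 Hf; have [lc lelt] := lowdegP f0.
have tc : f`_(topdeg f) != 0 by rewrite -[f`_ _]/(lead_coef f) lead_coef_eq0.
(* A negative [l] would make every coefficient vanish. *)
have [l' El] : exists l' : nat, l = l'%:Z.
  exists `|l|%N; case: (ltP l 0) => [lt0|]; last lia.
  by case/eqP: lc; apply: (qspan_deg Hf); lia.
have le1 (i : nat) : f`_i != 0 -> (i <= l')%N.
  by apply: contraNT => lti; apply/eqP/(qspan_deg Hf); lia.
have h1 : (lowdeg f <= l' - topdeg f)%N.
  apply: lowdeg_min; rewrite -(@qspan_sym _ _ _ (topdeg f) _ Hf) //.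
  by have := le1 _ tc; lia.
have h2 : (l' - lowdeg f <= topdeg f)%N.
  apply: topdeg_max; rewrite -(@qspan_sym _ _ _ (lowdeg f) _ Hf) //.
  by have := le1 _ lc; lia.
by have := le1 _ tc; have := le1 _ lc; rewrite /darga; lia.
Qed.

Lemma qspan_symmetric_poly (s : bool) (l : int) (f : {poly int}) :
  f != 0 -> qspan s l f -> symmetric_poly f.
Proof.
move=> f0 Hf k Hk; apply: (qspan_sym Hf); rewrite -(qspan_darga f0 Hf) /darga.
by have [_] := lowdegP f0; lia.
Qed.

Lemma qspan_zero_or_symmetric (s : bool) (l : int) (f : {poly int}) :
  qspan s l f -> zero_or_symmetric l f.
Proof.
move=> Hf; case: (eqVneq f 0) => f0; [by left | right].
by split; [apply: (qspan_symmetric_poly f0 Hf) | apply: (qspan_darga f0 Hf)].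
Qed.

Lemma qspan_zsu (l : int) (f : {poly int}) : qspan false l f -> zsu l f.
Proof.
move=> Hf; case: (eqVneq f 0) => f0; [by left | right].
have El := qspan_darga f0 Hf; have [_ lelt] := lowdegP f0.
move: El; rewrite /darga => El.
split; [by move=> j; apply: qspan_ge0 Hf | exact: qspan_symmetric_poly Hf | | done].
(* The peak is the middle [l / 2]; the descending half is the reflection of the ascending one. *)
exists ((lowdeg f + topdeg f)./2); split; first lia.
  by move=> j Hj; apply: (qspan_incr Hf); lia.
move=> j Hj.
rewrite (@qspan_sym _ _ _ j.+1 (lowdeg f + topdeg f - j.+1) Hf); last lia.
rewrite (@qspan_sym _ _ _ j (lowdeg f + topdeg f - j.+1).+1 Hf); last lia.
by apply: (qspan_incr Hf); lia.
Qed.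

(** A symmetric sequence is cut into centred strings: the one occupying the degrees [i, ..., l - i]
    has as multiplicity the jump from coefficient [i - 1] to coefficient [i]. *)
Lemma qspan_intro (l : nat) (f : {poly int}) :
    (forall i j, (i + j)%N = l -> f`_i = f`_j) ->
    (forall i, (l < i)%N -> f`_i = 0) ->
    (forall i, 0 <= f`_i) ->
    (forall i, (i.*2 < l)%N -> f`_i <= f`_i.+1) ->
  qspan false l f.
Proof.
move=> Hs Hd H0 Hi.
pose c i : int := f`_i - (if i is i'.+1 then f`_i' else 0).
have -> : f = \sum_(i < l./2.+1) c i *: ('X^i * qint (l.+1 - i.*2)).
  apply/polyP => j; rewrite coef_sum.
  under eq_bigr do rewrite coefZ coef_qspan_gen.
  have tel n : \sum_(i < n.+1) c i = f`_n.
    elim: n => [|n IH]; first by rewrite big_ord1 /c subr0.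
    by rewrite big_ord_recr /= IH addrC /c subrK.
  case: (ltnP l j) => [ltlj|lejl].
    rewrite Hd // big1 // => i _.
    by have -> : ((i <= j) && (j < i + (l.+1 - i.*2)))%N = false; [lia | rewrite mulr0].
  (* Folded into the left half, the coefficient is the telescoping sum of the jumps over the strings
     that contain degree [j]. *)
  have -> : f`_j = f`_(minn j (l - j)).
    by rewrite /minn; case: ltnP => // _; apply: Hs; lia.
  rewrite -tel.
  have le_m : ((minn j (l - j)).+1 <= l./2.+1)%N by lia.
  rewrite (big_ord_widen _ c le_m) big_mkcond; apply: eq_bigr => i _.
  have := ltn_ord i; rewrite -[(i < l./2.+1)%N]/(i <= l./2)%N => lei.
  have -> : ((i <= j) && (j < i + (l.+1 - i.*2)))%N = (i < (minn j (l - j)).+1)%N by lia.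
  by case: ifP; rewrite ?mulr1 ?mulr0.
apply: qspan_sum => i _.
have ci : 0 <= c i.
  rewrite /c; case: i => [[|i] /= lti]; first by rewrite subr0.
  by rewrite subr_ge0 Hi //; lia.
have -> : c i = (`|c i|%N)%:R by rewrite natz gez0_abs.
rewrite scaler_nat; elim: `|c i|%N => [|n IH]; first by rewrite mulr0n; apply: qspan0.
rewrite mulrSr; apply: qspanD => //; apply: qspan_int.
by have := ltn_ord i; lia.
Qed.

(** * Numerators of generating functions *)

Implicit Types A B : nat -> {poly int}.

(* Multiplication of [sum_j A_j x^j] by [1 - x q^i]. *)
Definition qdiff (i : nat) A : nat -> {poly int} :=
  fun j => if j is j'.+1 then A j - 'X^i * A j' else A 0%N.

(* Multiplication by [(1 - x) (1 - x q) ... (1 - x q^(n-1))]. *)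
Fixpoint qnum (n : nat) A : nat -> {poly int} :=
  if n is n'.+1 then qnum n' (qdiff n' A) else A.

Lemma eq_qdiff (i : nat) A B : A =1 B -> qdiff i A =1 qdiff i B.
Proof. by move=> E [|j]; rewrite /qdiff !E. Qed.

Lemma eq_qnum (n : nat) A B : A =1 B -> qnum n A =1 qnum n B.
Proof. by elim: n A B => [|n IH] A B E //=; apply/IH/eq_qdiff. Qed.

Lemma qdiffC (i j : nat) A : qdiff i (qdiff j A) =1 qdiff j (qdiff i A).
Proof. by case=> [|[|m]] //=; ring. Qed.

(** The recursion applies the factor of highest index first; as the factors commute, it can also be
    applied last. *)
Lemma qnumS (n : nat) A : qnum n.+1 A =1 qdiff n (qnum n A).
Proof.
have H i : qnum n (qdiff i A) =1 qdiff i (qnum n A).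
  elim: n A => [|n IH] A //= m.
  by rewrite (eq_qnum n (qdiffC n i A)) IH.
exact: H.
Qed.

Arguments qnum : simpl never.

Lemma qnum_linear (n : nat) (c1 c2 : {poly int}) A B (m : nat) :
  qnum n (fun j => c1 * A j + c2 * B j) m = c1 * qnum n A m + c2 * qnum n B m.
Proof.
elim: n m => [|n IH] m //.
by rewrite !qnumS /qdiff; case: m => [|m]; rewrite !IH; ring.
Qed.

Lemma qnumZ (n : nat) (c : {poly int}) A (m : nat) :
  qnum n (fun j => c * A j) m = c * qnum n A m.
Proof.
have := qnum_linear n c 0 A A m; rewrite mul0r addr0 => <-.
by apply: eq_qnum => j; rewrite mul0r addr0.
Qed.

(** The q-binomial theorem for [prod_(i < n) (1 - x q^i)], by induction through the second Pascal
    rule. *)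
Lemma qnum_expand (n : nat) A (m : nat) :
  qnum n A m = \sum_(r < m.+1) (-1) ^+ r * 'X^('C(r, 2)) * qbinom n r * A (m - r)%N.
Proof.
elim: n m => [|n IH] m.
  rewrite big_ord_recl big1 ?addr0 /=; last by move=> i _; rewrite mulr0 mul0r.
  by rewrite expr0 subn0 !mul1r.
rewrite qnumS /qdiff; case: m => [|m].
  by rewrite IH !big_ord1 !qbinom0.
rewrite !IH big_ord_recl [RHS]big_ord_recl !qbinom0 -addrA; congr (_ + _).
rewrite mulr_sumr -sumrB; apply: eq_bigr => r _; rewrite !lift0 subSS.
rewrite qbinomS' mulrDr mulrDl; congr (_ + _).
case: (leqP r n) => [lern|ltnr]; last by rewrite !(qbinom_small ltnr) !(mulr0, mul0r) oppr0.
rewrite -[in 'X^n](subnK lern) binS bin1 !exprD exprS; ring.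
Qed.

Lemma qdiff_qbinom (a : nat) :
  qdiff a.+1 (fun j => qbinom (j + a.+1) a.+1) =1 (fun j => qbinom (j + a) a).
Proof.
case=> [|j]; rewrite /qdiff; first by rewrite !add0n !qbinomnn.
by rewrite addSn qbinomS addrAC subrr add0r addSnnS.
Qed.

(** The series [sum_j qbinom (j + a) a x^j] is the inverse of [prod_(i <= a) (1 - x q^i)]: by
    Pascal's rule the factor of index [a] lowers [a] by one. *)
Lemma qnum_qbinom (a : nat) :
  qnum a.+1 (fun j => qbinom (j + a) a) =1 (fun m => (m == 0)%N%:R).
Proof.
elim: a => [|a IH] m.
  by case: m => [|m]; rewrite qnumS /qdiff /qnum ?expr0 ?mul1r !qbinom0 ?subrr.
by rewrite -IH -[LHS]/(qnum a.+1 _ m); apply/eq_qnum/qdiff_qbinom.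
Qed.

(** Inverts [qnum]: the numerator is multiplied by the inverse series found in [qnum_qbinom]. *)
Lemma qnumK (n : nat) A (j : nat) :
  A j = \sum_(m < j.+1) qnum n.+1 A m * qbinom (j - m + n) n.
Proof.
elim: n A j => [|n IHn] A j.
  under eq_bigr do rewrite qbinom0 mulr1.
  elim: j => [|j IHj]; first by rewrite big_ord1.
  by rewrite big_ord_recr /= -IHj qnumS /qdiff /qnum expr0 mul1r addrC subrK.
elim: j => [|j IHj].
  rewrite big_ord1 subnn add0n qbinomnn mulr1 (IHn A 0%N) big_ord1 add0n qbinomnn mulr1.
  by rewrite !qnum_expand !big_ord1 !qbinom0.
have -> : A j.+1 = qdiff n.+1 A j.+1 + 'X^(n.+1) * A j by rewrite /qdiff subrK.
rewrite (IHn (qdiff n.+1 A) j.+1) IHj -[qnum n.+1 (qdiff _ _)]/(qnum n.+2 A).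
rewrite big_ord_recr [RHS]big_ord_recr /= !subnn !add0n !qbinomnn addrAC; congr (_ + _).
rewrite mulr_sumr -big_split; apply: eq_bigr => i _ /=.
have lti : (i <= j)%N by rewrite -ltnS.
rewrite subSn // !addSn !addnS [in RHS]qbinomS; ring.
Qed.

(** The argument of [qnum] has generating function [sum_m f_m x^m G_m(x)], and multiplication by a
    polynomial in [x] acts on each [G_m] separately. *)
Lemma qnum_conv (k : nat) (f : nat -> {poly int}) (g : nat -> nat -> {poly int}) (s : nat) :
  qnum k (fun j => \sum_(m < j.+1) f m * g m (j - m)%N) s
  = \sum_(m < s.+1) f m * qnum k (g m) (s - m)%N.
Proof.
elim: k s => [|k IH] s //; rewrite qnumS /qdiff.
case: s => [|s]; first by rewrite IH !big_ord1 qnumS.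
rewrite !IH [in RHS]big_ord_recr [in LHS]big_ord_recr /= !subnn qnumS /=.
rewrite addrAC; congr (_ + _); rewrite mulr_sumr -sumrB; apply: eq_bigr => i _.
have lti : (i <= s)%N by rewrite -ltnS.
by rewrite subSn // qnumS /=; ring.
Qed.

Lemma qnum_qbinom_shift (a b r : nat) :
  qnum (a + b).+1 (fun j => qbinom (j + a) (a + b)) r = (r == b)%:R.
Proof.
rewrite (@eq_qnum _ _ (fun j =>
  \sum_(m < j.+1) (m == b :> nat)%:R * qbinom (j - m + (a + b)) (a + b))).
  rewrite (qnum_conv _ (fun m => (m == b :> nat)%:R) (fun _ j => qbinom (j + (a + b)) (a + b))).
  rewrite big_ord_recr big1 /= ?add0r => [|i _].
    by rewrite subnn qnum_qbinom mulr1.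
  by rewrite qnum_qbinom subn_eq0 leqNgt ltn_ord mulr0.
move=> j; case: (leqP b j) => [lebj|ltjb].
  rewrite (bigD1 (inord b)) //= inordK // eqxx mul1r big1 ?addr0 => [|i].
    by congr qbinom; lia.
  rewrite -val_eqE /= inordK // => /negPf->; by rewrite mul0r.
rewrite qbinom_small ?big1 // => [i _|]; last lia.
by case: eqP => [E|_]; rewrite ?mul0r //; have := ltn_ord i; lia.
Qed.

(* A q-analogue of Nanjundiah's identity. *)
Lemma qnum_qbinom_mul (a b al : nat) : (al <= a + b)%N ->
  forall r, qnum (a + b).+1 (fun j => qbinom (j + a) a * qbinom (j + al) b) r =
    if (r <= b)%N then
      'X^(r * (al - (b - r))) * qbinom al (b - r) * qbinom (a + b - al) r
    else 0.
Proof.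
elim: al b => [|al IH] b le_al r.
  (* For [al = 0] the product is a constant times one q-binomial in [j], and only [x^b] survives. *)
  rewrite (@eq_qnum _ _ (fun j => qbinom (a + b) b * qbinom (j + a) (a + b))); last first.
    by move=> j; rewrite addn0 qbinom_mul.
  rewrite qnumZ subn0.
  rewrite qnum_qbinom_shift.
  case: (ltngtP r b) => [ltrb|//|->]; rewrite ?mulr0 //.
    by rewrite (@qbinom_small 0 (b - r)) ?subn_gt0 // !(mulr0, mul0r).
  by rewrite subnn muln0 expr0 !mul1r mulr1.
case: b le_al => [|b] le_al.
  rewrite (@eq_qnum _ _ (fun j => qbinom (j + a) a)); last first.
    by move=> j; rewrite qbinom0 mulr1.
  rewrite addn0 qnum_qbinom; case: r => [|r] //=.
  by rewrite mul0n !qbinom0 expr0 !mulr1.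
have H1 := IH b.+1 (ltnW le_al).
rewrite addnS ltnS in le_al; have H2 := IH b le_al.
(* Pascal's rule on [j + al + 1] leaves two series with argument [al]. The second has the smaller
   [b], so its numerator carries the extra factor [1 - x q^(a+b+1)]. *)
have -> : qnum (a + b.+1).+1 (fun j => qbinom (j + a) a * qbinom (j + al.+1) b.+1) r
  = 'X^(b.+1) * qnum (a + b.+1).+1 (fun j => qbinom (j + a) a * qbinom (j + al) b.+1) r
    + qnum (a + b.+1).+1 (fun j => qbinom (j + a) a * qbinom (j + al) b) r.
  rewrite -[X in _ + X]mul1r -qnum_linear; apply: eq_qnum => j.
  by rewrite addnS qbinomS; ring.
rewrite H1 {H1} addnS qnumS /qdiff.
case: r => [|r].
  rewrite !H2 /= !subn0 !mul0n !qbinom0 !expr0 !mul1r !mulr1.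
  by rewrite qbinomS.
rewrite !H2 {H2 IH} ltnS; case: (ltngtP r b) => [ltrb|ltbr|->].
- rewrite ?(ltnW ltrb) !subSS.
  have [p Ep] : exists p, (b - r)%N = p.+1 by exists (b - r).-1; rewrite prednK // subn_gt0.
  have -> : (b - r.+1)%N = p by lia.
  rewrite Ep subSS.
  have -> : ((a + b).+1 - al)%N = (a + b - al).+1 by lia.
  rewrite [qbinom al.+1 _]qbinomS [qbinom (_ - _).+1 _]qbinomS'.
  (* Vanishing q-binomials are treated apart, so that the truncated exponents below are true
     differences. *)
  case: (leqP p al) => [lepa|ltap]; last first.
    have z1 : qbinom al p = 0 by rewrite qbinom_small.
    have z2 : qbinom al p.+1 = 0 by rewrite qbinom_small // ltnW.
    by rewrite z1 z2; ring.
  case: (leqP p.+1 al) => [ltpa|leap]; last first.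
    rewrite (@qbinom_small al p.+1); last lia.
    have -> : p = al by lia.
    by rewrite subnn muln0 expr0; ring.
  case: (leqP r (a + b - al)) => [ler|ltr]; last first.
    have z1 : qbinom (a + b - al) r = 0 by rewrite qbinom_small.
    have z2 : qbinom (a + b - al) r.+1 = 0 by rewrite qbinom_small // ltnW.
    by rewrite z1 z2; ring.
  set u := qbinom al p.+1; set v := qbinom al p.
  set w := qbinom _ r.+1; set z := qbinom _ r.
  have E1 : 'X^(r.+1 * (al - p)) = 'X^(r.+1 * (al - p.+1)) * 'X^(r.+1) :> {poly int}.
    by rewrite -exprD; congr ('X^_); rewrite -{3}(muln1 r.+1) -mulnDr; congr muln; lia.
  have E2 : 'X^(b.+1) = 'X^(p.+1) * 'X^(r.+1) :> {poly int}.
    by rewrite -exprD; congr ('X^_); lia.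
  have E3 : 'X^((a + b).+1) * 'X^(r * (al - p.+1))
    = 'X^(b.+1) * 'X^(r.+1 * (al - p.+1)) * 'X^(a + b - al - r) :> {poly int}.
    rewrite -!exprD; congr ('X^_); rewrite mulSn; lia.
  rewrite !mulrA.
  rewrite E3 E1 E2; ring.
- by rewrite !mulr0 subr0 addr0.
- rewrite !subnn !subn0 !qbinom0 subSS.
  have -> : ((a + b).+1 - al)%N = (a + b - al).+1 by lia.
  rewrite qbinomS'.
  case: (leqP b (a + b - al)) => [leb|ltb]; last first.
    have z1 : qbinom (a + b - al) b = 0 by rewrite qbinom_small.
    have z2 : qbinom (a + b - al) b.+1 = 0 by rewrite qbinom_small // ltnW.
    by rewrite z1 z2; ring.
  have E1 : 'X^(b.+1 * al.+1) = 'X^(b.+1) * 'X^(b.+1 * al) :> {poly int}.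
    by rewrite -exprD mulnS.
  have E3 : 'X^((a + b).+1) * 'X^(b * al)
    = 'X^(b.+1) * 'X^(b.+1 * al) * 'X^(a + b - al - b) :> {poly int}.
    by rewrite -!exprD; congr ('X^_); rewrite !mulSn; lia.
  by rewrite !mulrA !mulr1 E3 E1; ring.
Qed.

(** * Unimodality of q-binomials *)

Section SubsetSums.

Variable N : nat.
Implicit Types (i j : 'I_N) (S : {set 'I_N.+1}) (v : {set 'I_N.+1} -> rat).

Definition set_sum S : nat := (\sum_(x in S) x)%N.

Definition lo i : 'I_N.+1 := widen_ord (leqnSn N) i.
Definition hi i : 'I_N.+1 := lift ord0 i.

Lemma val_lo i : lo i = i :> nat. Proof. by []. Qed.
Lemma val_hi i : hi i = i.+1 :> nat. Proof. exact: lift0. Qed.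

Definition swap i S : {set 'I_N.+1} := [set x | tperm (lo i) (hi i) x \in S].

Lemma swapK i : involutive (swap i).
Proof. by move=> S; apply/setP => x; rewrite !inE tpermK. Qed.

Lemma lo_swap i S : (lo i \in swap i S) = (hi i \in S).
Proof. by rewrite inE tpermL. Qed.

Lemma hi_swap i S : (hi i \in swap i S) = (lo i \in S).
Proof. by rewrite inE tpermR. Qed.

Lemma swap_other i S (x : 'I_N.+1) :
  x != lo i -> x != hi i -> (x \in swap i S) = (x \in S).
Proof. by move=> H1 H2; rewrite inE tpermD // eq_sym. Qed.

Lemma card_swap i S : #|swap i S| = #|S|.
Proof.
apply: on_card_preimset; apply: onW_bij; exists (tperm (lo i) (hi i)); exact: tpermK.
Qed.

Lemma set_sum_swap i S :
  lo i \in S -> hi i \notin S -> set_sum (swap i S) = (set_sum S).+1.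
Proof.
move=> Hl Hh; rewrite /set_sum (reindex_inj (@perm_inj _ (tperm (lo i) (hi i)))).
under eq_bigl do rewrite inE tpermK.
rewrite (bigD1 (lo i)) //= [in RHS](bigD1 (lo i)) //= tpermL -addSn lift0; congr (_ + _)%N.
apply: eq_bigr => x /andP[xS xl]; rewrite tpermD // eq_sym //.
by apply: contraNneq Hh => <-.
Qed.

Lemma swapC i j S : (i.+1 < j)%N || (j.+1 < i)%N -> swap i (swap j S) = swap j (swap i S).
Proof.
move=> Hij; apply/setP => x; rewrite !inE.
have ne (a b : 'I_N) : (a.+1 < b)%N || (b.+1 < a)%N ->
   [/\ lo a != lo b, lo a != hi b, hi a != lo b & hi a != hi b].
  by move=> H; rewrite -!(inj_eq (@ord_inj _)) !(val_lo, val_hi); split; lia.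
have [a1 a2 a3 a4] := ne i j Hij.
have [b1 b2 b3 b4] : [/\ lo j != lo i, lo j != hi i, hi j != lo i & hi j != hi i].
  by split; rewrite eq_sym.
congr (_ \in S).
case: (tpermP (lo i) (hi i) x) => [->|->|/eqP x1 /eqP x2].
- by rewrite [tperm (lo j) _ (lo i)]tpermD // tpermL tpermD.
- by rewrite [tperm (lo j) _ (hi i)]tpermD // tpermR tpermD.
- by case: (tpermP (lo j) (hi j) x) => [_|_|_ _]; rewrite tpermD // eq_sym.
Qed.

Definition raisable i S := (lo i \in S) && (hi i \notin S).
Definition lowerable i S := (hi i \in S) && (lo i \notin S).

Definition up v S : rat := \sum_(i < N) (lowerable i S)%:R * v (swap i S).

(* With these weights [up] and [down] generate sl2 acting on the exterior
   powers of an irreducible representation with basis indexed by ['I_N.+1]; no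
   signs occur because moving an element to an adjacent free place preserves
   the order. *)
Definition wt (x : nat) : rat := x%:R * (N.+1%:R - x%:R).

Definition down v S : rat := \sum_(i < N) wt i.+1 * (raisable i S)%:R * v (swap i S).

(** Moves at distant places commute. At adjacent places both sides vanish, since each requires some
    place to be both occupied and empty. *)
Lemma up_down_offdiag i j v S : i != j ->
  (lowerable i S)%:R * ((raisable j (swap i S))%:R * v (swap j (swap i S)))
  = (raisable j S)%:R * ((lowerable i (swap j S))%:R * v (swap i (swap j S))).
Proof.
move=> neij; rewrite /lowerable /raisable.
have hilo (a b : 'I_N) : a = b.+1 :> nat -> lo a = hi b.
  by move=> E; apply: ord_inj; rewrite val_lo val_hi.
have [E|E] := eqVneq (i : nat) j.+1.
  rewrite (hilo _ _ E) (hi_swap j) -(hilo _ _ E) (lo_swap i).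
  by case: (hi i \in S); case: (lo j \in S); rewrite /= ?andbF ?mul0r ?mulr0.
have [E'|E'] := eqVneq (j : nat) i.+1.
  rewrite (hilo _ _ E') (hi_swap i) -(hilo _ _ E') (lo_swap j).
  rewrite (hilo _ _ E').
  by case: (hi i \in S); case: (lo i \in S); case: (hi j \in S); rewrite /= ?andbF ?mul0r ?mulr0.
have far : ((i.+1 < j) || (j.+1 < i))%N by move: neij E E'; rewrite -val_eqE /=; lia.
have ne (a b : 'I_N) : ((a.+1 < b) || (b.+1 < a))%N ->
   [/\ lo a != lo b, lo a != hi b, hi a != lo b & hi a != hi b].
  by move=> H; rewrite -!(inj_eq (@ord_inj _)) !(val_lo, val_hi); split; lia.
have [a1 a2 a3 a4] := ne i j far.
have far' : ((j.+1 < i) || (i.+1 < j))%N by rewrite orbC.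
have [b1 b2 b3 b4] := ne j i far'.
rewrite !swap_other // (swapC _ far).
by rewrite !mulrA [_%:R * _%:R]mulrC.
Qed.

Lemma up_down_diag i v S :
  (lowerable i S)%:R * ((raisable i (swap i S))%:R * v (swap i (swap i S)))
  - (raisable i S)%:R * ((lowerable i (swap i S))%:R * v (swap i (swap i S)))
  = ((hi i \in S)%:R - (lo i \in S)%:R) * v S.
Proof.
rewrite /lowerable /raisable !lo_swap !hi_swap swapK.
by case: (hi i \in S); case: (lo i \in S); rewrite /= ?(mul0r, mul1r, subrr, subr0, sub0r) ?mulN1r.
Qed.

Lemma up_down v S :
  up (down v) S = down (up v) S + ((set_sum S).*2%:R - (N * #|S|)%:R) * v S.
Proof.
apply/eqP; rewrite addrC -subr_eq; apply/eqP.
have -> : up (down v) S = \sum_(i < N) \sum_(j < N) wt j.+1 *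
   ((lowerable i S)%:R * ((raisable j (swap i S))%:R * v (swap j (swap i S)))).
  by apply: eq_bigr => i _; rewrite mulr_sumr; apply: eq_bigr => j _; ring.
have -> : down (up v) S = \sum_(i < N) \sum_(j < N) wt j.+1 *
   ((raisable j S)%:R * ((lowerable i (swap j S))%:R * v (swap i (swap j S)))).
  rewrite exchange_big; apply: eq_bigr => j _; rewrite mulr_sumr.
  by apply: eq_bigr => i _; ring.
rewrite -sumrB.
transitivity (\sum_(i < N) wt i.+1 * ((hi i \in S)%:R - (lo i \in S)%:R) * v S).
  apply: eq_bigr => i _; rewrite -sumrB (bigD1 i) //= big1 ?addr0 => [|j neji].
    by rewrite -mulrBr up_down_diag mulrA.
  by rewrite up_down_offdiag 1?eq_sym // subrr.
rewrite -mulr_suml; congr (_ * _).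
under eq_bigr do rewrite mulrBr; rewrite sumrB.
(* [wt] vanishes at [0] and [N + 1], so both sums extend over all [x]; an element [x] of [S] then
   contributes [wt x - wt (x + 1) = 2 x - N]. *)
have -> : \sum_(i < N) wt i.+1 * (hi i \in S)%:R = \sum_(x < N.+1) wt x * (x \in S)%:R.
  rewrite big_ord_recl [X in _ = X + _](_ : _ = 0) ?add0r; last by rewrite [wt _]mul0r mul0r.
  by apply: eq_bigr => i _; rewrite -[lift ord0 i]/(hi i) val_hi.
have -> : \sum_(i < N) wt i.+1 * (lo i \in S)%:R = \sum_(x < N.+1) wt x.+1 * (x \in S)%:R.
  by rewrite big_ord_recr /= [wt N.+1]/wt subrr mulr0 mul0r addr0.
rewrite -sumrB -sum1_card /set_sum -mul2n big_distrr natr_sum big_distrr natr_sum -sumrB.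
rewrite [RHS]big_mkcond; apply: eq_bigr => x _.
case: ifP => _ /=; rewrite ?mulr0 ?subrr // !mulr1 muln1 /wt natrM.
by rewrite -![_.+1%:R]natr1; ring.
Qed.

Definition level (k r : nat) : {set {set 'I_N.+1}} :=
  [set S : {set 'I_N.+1} | (#|S| == k) && (set_sum S == r)].

Lemma down_supp (k r : nat) v :
    (forall S, v S != 0 -> S \in level k r.+1) ->
  forall S, down v S != 0 -> S \in level k r.
Proof.
move=> Hv S dS; have [i Hi] : exists i : 'I_N, wt i.+1 * (raisable i S)%:R * v (swap i S) != 0.
  apply/existsP; apply: contraNT dS; rewrite negb_exists => /forallP H.
  by apply/eqP; apply: big1 => i _; apply/eqP; rewrite -[_ == _]negbK.
have := Hi; rewrite !mulf_eq0 !negb_or => /andP[/andP[_ Hr]] /Hv.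
have {Hr} /andP[Hr1 Hr2] : raisable i S by move: Hr; case: raisable; rewrite ?eqxx.
by rewrite !inE card_swap set_sum_swap.
Qed.

(* If [up v = 0], then [up (down^(j+1) v)] is a negative multiple of
   [down^j v], while [down^(r+1) v = 0]. *)
Lemma up_inj (k r : nat) v : (r.*2 < N * k)%N ->
    (forall S, v S != 0 -> S \in level k r) ->
  up v =1 (fun=> 0) -> v =1 (fun=> 0).
Proof.
move=> ltr Hv up0.
have E_down v1 v2 : v1 =1 v2 -> down v1 =1 down v2.
  by move=> E S; apply: eq_bigr => i _; rewrite E.
have E_up v1 v2 : v1 =1 v2 -> up v1 =1 up v2.
  by move=> E S; apply: eq_bigr => i _; rewrite E.
have supp (j : nat) : (j <= r)%N -> forall S, iter j down v S != 0 -> S \in level k (r - j).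
  elim: j => [_ S|j IH ltj S]; first by rewrite subn0 => /Hv.
  by apply: down_supp => T; rewrite subnSK //; apply: IH; apply: ltnW.
(* The constants start at [2 r - N k < 0], and the commutator adds [2 (r - j - 1) - N k < 0] each
   time. *)
have step (j : nat) : (j <= r)%N -> exists2 a : rat, a < 0
    & forall S, up (iter j.+1 down v) S = a * iter j down v S.
  elim: j => [|j IH] lej.
    exists (r.*2%:R - (N * k)%:R); first by rewrite subr_lt0 ltr_nat.
    move=> S; rewrite /= up_down (E_down _ _ up0).
    have -> : down (fun=> 0) S = 0 by apply: big1 => i _; rewrite mulr0.
    rewrite add0r; have [->|/Hv] := eqVneq (v S) 0; first by rewrite !mulr0.
    by rewrite inE => /andP[/eqP-> /eqP->].
  have [a a0 Ha] := IH (ltnW lej).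
  exists (a + ((r - j.+1).*2%:R - (N * k)%:R)).
    rewrite -[0]addr0 ltrD // subr_lt0 ltr_nat; lia.
  move=> S; rewrite [iter j.+2 down v]iterS up_down (E_down _ _ Ha).
  have -> : down (fun T => a * iter j down v T) S = a * iter j.+1 down v S.
    by rewrite [RHS]mulr_sumr; apply: eq_bigr => i _; rewrite mulrCA.
  rewrite [RHS]mulrDl; congr (_ + _).
  have [->|] := eqVneq (iter j.+1 down v S) 0; first by rewrite !mulr0.
  by move/(supp j.+1 lej); rewrite inE => /andP[/eqP-> /eqP->].
(* No set has negative sum, so [down^(r+1) v = 0]; dividing by the nonzero [a] climbs back to
   [v = 0]. *)
have zero (j : nat) : (j <= r.+1)%N -> iter (r.+1 - j) down v =1 (fun=> 0).
  elim: j => [_|j IH ltj] S.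
    rewrite subn0 iterS; apply: big1 => i _; apply/eqP; rewrite mulf_eq0.
    have [_|/(supp r (leqnn r))] := eqVneq (iter r down v (swap i S)) 0; first by rewrite orbT.
    rewrite subnn inE => /andP[_ /eqP E]; apply/orP; left.
    rewrite mulf_eq0 orbC; case Hr: (raisable i S); rewrite ?eqxx //.
    by move/andP: Hr => [H1 H2]; move: E; rewrite set_sum_swap.
  have lej : (r - j <= r)%N by lia.
  have [a a0 Ha] := step _ lej; rewrite subSS.
  have := Ha S; have E : (r - j).+1 = (r.+1 - j)%N by lia.
  rewrite E (E_up _ _ (IH (ltnW ltj))).
  have -> : up (fun=> 0) S = 0 by apply: big1 => i _; rewrite mulr0.
  by move/esym/eqP; rewrite mulf_eq0 lt_eqF //= => /eqP.
by have := zero r.+1 (leqnn _); rewrite subnn.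
Qed.

(** [up] from level [r] to level [r + 1] is injective, so its matrix has full row rank, which is at
    most the number of columns. *)
Lemma leq_card_level (k r : nat) : (r.*2 < N * k)%N ->
  (#|level k r| <= #|level k r.+1|)%N.
Proof.
move=> ltr.
pose A : 'M[rat]_(#|level k r|, #|level k r.+1|) :=
  \matrix_(a, b) \sum_i (lowerable i (enum_val b))%:R * (enum_val a == swap i (enum_val b))%:R.
suff : row_free A by rewrite /row_free => /eqP <-; apply: rank_leq_col.
apply/row_freeP.
suff kA0 : kermx A = 0.
  by apply/row_freeP; rewrite -kermx_eq0 kA0.
apply/row_matrixP => c; rewrite row0; set u := row c _.
have uA : u *m A = 0 by apply/sub_kermxP; rewrite row_sub.
pose v S : rat := \sum_a u 0 a * (enum_val a == S)%:R.
have Hv S : v S != 0 -> S \in level k r.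
  apply: contraNT => Sn; apply/eqP; apply: big1 => a _.
  case: eqP => [E|_]; last by rewrite mulr0.
  by move: Sn; rewrite -E enum_valP.
have uv a : u 0 a = v (enum_val a).
  rewrite /v (bigD1 a) //= eqxx mulr1 big1 ?addr0 // => b neba.
  by rewrite (inj_eq enum_val_inj) (negPf neba) mulr0.
suff v0 : v =1 (fun=> 0) by apply/rowP => a; rewrite uv v0 mxE.
apply: (up_inj ltr Hv) => S.
case: (boolP (S \in level k r.+1)) => [SL|SnL].
  have := congr1 (fun M : 'rV_ _ => M 0 (enum_rank_in SL S)) uA.
  rewrite !mxE => <-; rewrite /up.
  under [RHS]eq_bigr do rewrite [A _ _]mxE enum_rankK_in // mulr_sumr.
  rewrite exchange_big; apply: eq_bigr => i _; rewrite mulr_sumr.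
  by apply: eq_bigr => a _; rewrite mulrCA.
apply: big1 => i _; case Hl: (lowerable i S); last by rewrite mul0r.
have [->|] := eqVneq (v (swap i S)) 0; first by rewrite mulr0.
move/Hv => Hs; case/negP: SnL; move: Hs; rewrite !inE card_swap => /andP[-> /eqP <-].
case/andP: Hl => Hh Hl; rewrite -{1}(swapK i S) set_sum_swap ?lo_swap ?hi_swap //.
by rewrite eqxx.
Qed.

Definition rev_set S : {set 'I_N.+1} := [set x | rev_ord x \in S].

Lemma rev_setK : involutive rev_set.
Proof. by move=> S; apply/setP => x; rewrite !inE rev_ordK. Qed.

Lemma card_rev_set S : #|rev_set S| = #|S|.
Proof.
by apply: on_card_preimset; apply: onW_bij; exists (@rev_ord _); apply: rev_ordK.
Qed.

Lemma set_sum_rev S : (set_sum (rev_set S) + set_sum S)%N = (N * #|S|)%N.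
Proof.
rewrite /set_sum (reindex_inj rev_ord_inj).
under eq_bigl do rewrite inE rev_ordK.
rewrite -big_split -sum1_card big_distrr; apply: eq_bigr => x _ /=.
by rewrite muln1 subSS subnK // -ltnS.
Qed.

Lemma card_level_sym (k r r' : nat) : (r + r')%N = (N * k)%N -> #|level k r| = #|level k r'|.
Proof.
have le (a b : nat) : (a + b)%N = (N * k)%N -> (#|level k a| <= #|level k b|)%N.
  move=> E; rewrite -(card_imset _ (inv_inj rev_setK)); apply/subset_leq_card/subsetP => T.
  case/imsetP => S; rewrite inE => /andP[/eqP Ek /eqP Ea ->].
  rewrite inE card_rev_set Ek eqxx /=.
  by have := set_sum_rev S; rewrite Ek Ea; lia.
by move=> E; apply/eqP; rewrite eqn_leq !le // addnC.
Qed.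

Lemma level_eq0 (k r : nat) : (N * k < r)%N -> level k r = set0.
Proof.
move=> ltr; apply/setP => S; rewrite !inE; apply/negP => /andP[/eqP Ek /eqP Er].
by have := set_sum_rev S; rewrite Ek Er; lia.
Qed.

End SubsetSums.

(** * q-binomials as generating functions of subset sums *)

Lemma coef_prod_qbinom (n k : nat) :
  (\prod_(i < n) (1 + ('X^i)%:P * 'X) : {poly {poly int}})`_k = 'X^('C(k, 2)) * qbinom n k.
Proof.
elim: n k => [|n IH] k.
  by rewrite big_ord0 coef1; case: k => [|k]; rewrite ?qbinom0 ?mulr1 // qbinom_small // mulr0.
rewrite big_ord_recr /= mulrDr mulr1 coefD mulrA coefMX mulrC.
case: k => [|k] /=; first by rewrite IH !qbinom0 addr0.
rewrite coefCM !IH qbinomS' mulrDr; congr (_ + _).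
case: (leqP k n) => [lekn|ltnk]; last by rewrite !(qbinom_small ltnk) !mulr0.
by rewrite -[in 'X^n](subnK lekn) binS bin1 !exprD; ring.
Qed.

(** In the expansion of [prod_(i <= n) (1 + q^i x)], a [k]-set [S] records the factors from which
    [q^i x] is taken. *)
Lemma coef_level (n k r : nat) :
  ('X^('C(k, 2)) * qbinom n.+1 k)`_r = #|level n k r|%:R.
Proof.
rewrite -coef_prod_qbinom.
under eq_bigr do rewrite addrC; rewrite bigA_distr !coef_sum -sum1_card natr_sum.
rewrite [RHS]big_mkcond; apply: eq_bigr => S _.
rewrite -big_mkcond big_split prodr_const /= -rmorph_prod -expr_sum coefCM coefXn inE.
rewrite eq_sym; case: eqP => _ /=; last by rewrite mulr0 coef0.
by rewrite mulr1 coefXn -[\sum_(i in S) _]/(set_sum S) eq_sym; case: eqP.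
Qed.

Lemma qspan_qbinom (s : bool) (n k : nat) : (k <= n)%N ->
  qspan s (k * (n - k))%N%:Z (qbinom n k).
Proof.
move=> lekn; apply: qspanW; case: n lekn => [|n] lekn.
  by move: lekn; rewrite leqn0 => /eqP->; rewrite qbinom0; apply: qspan1.
have cE (j : nat) : (qbinom n.+1 k)`_j = #|level n k (j + 'C(k, 2))|%:R.
  by rewrite -coef_level coefXnM ltnNge leq_addl addnK.
(* Sums of [k]-sets are symmetric about [n k / 2]; removing [q^C(k,2)] moves the centre to
   [k (n + 1 - k) / 2]. *)
have E : (k * (n.+1 - k) + 'C(k, 2) + 'C(k, 2) = n * k)%N.
  rewrite -addnA addnn -mul2n -(mul_bin_diag k 1) bin1 -mulnDr mulnC.
  by case: k lekn {cE} => [|k'] lekn; rewrite ?muln0 // subSS subnK.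
apply: qspan_intro => [i j Hij|i Hi|i|i Hi]; rewrite !cE ?ler0n //.
- by congr (_ %:R); apply: card_level_sym; lia.
(* Above the top degree, reflection leads to sums below the least one, [C(k,2)]. *)
- case: (leqP (i + 'C(k, 2)) (n * k)) => [le|lt]; last by rewrite level_eq0 // cards0.
  have -> : #|level n k (i + 'C(k, 2))| = #|level n k (n * k - (i + 'C(k, 2)))|.
    by apply: card_level_sym; lia.
  by rewrite -coef_level coefXnM; have -> : (n * k - (i + 'C(k, 2)) < 'C(k, 2))%N by lia.
- by rewrite ler_nat; apply: leq_card_level; lia.
Qed.

(** * Rook placements on a Ferrers board *)

(** The exponents take each value from [0] to [#|A| - 1] once; induction removes the least element,
    which has the largest exponent. *)
Lemma sum_rank_qint (m : nat) (A : {set 'I_m}) :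
  \sum_(r in A) 'X^(#|[set x in A | (r < x)%N]|) = qint #|A|.
Proof.
elim: {A}#|A| {-2}A (erefl #|A|) => [|k IH] A cA.
  by move/eqP: (cA); rewrite cards_eq0 => /eqP->; rewrite big_set0 cards0 qint0.
have [x0 x0A] : exists x, x \in A by apply/card_gt0P; rewrite cA.
pose r0 := [arg min_(r < x0 in A) (r : nat)].
have [r0A r0min] : r0 \in A /\ forall r, r \in A -> (r0 <= r)%N.
  by rewrite /r0; case: arg_minnP.
have cA' : #|A :\ r0| = k by move: cA; rewrite (cardsD1 r0) r0A => -[].
rewrite cA -addn1 qintD qint1 mulr1 (big_setD1 r0) //= addrC; congr (_ + _).
  rewrite -cA' -IH //; apply: eq_bigr => r rA; congr ('X^_); apply: eq_card => x.
  rewrite !inE; case: (eqVneq x r0) => // -> /=.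
  move: rA; rewrite !inE => /andP[_ /r0min]; rewrite leqNgt => /negPf->.
  by rewrite andbF.
rewrite -cA'; congr ('X^_); apply: eq_card => x.
rewrite !inE andbC; case: (boolP (x \in A)) => [/r0min|]; last by rewrite !andbF.
by rewrite leq_eqVlt -val_eqE eq_sym /= !andbT; case: ltngtP.
Qed.

Section Rooks.

Variables (m n : nat) (b : nat -> nat).
Hypothesis b_mono : forall p q, (p <= q < n)%N -> (b p <= b q)%N.
Hypothesis b_le : forall p, (p < n)%N -> (b p <= m)%N.
Implicit Types (C D : {set 'I_m * 'I_n}) (s u : 'I_m * 'I_n).

(** All partial boards live in one grid, so that columns are added without changing the type. *)
Definition board (p : nat) : {set 'I_m * 'I_n} :=
  [set s : 'I_m * 'I_n | (s.2 < p)%N && (s.1 < b s.2)%N].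

Definition rook_rows C : {set 'I_m} := [set s.1 | s in C].

Definition free_rows (p : nat) C : {set 'I_m} :=
  [set r : 'I_m | (r < b p)%N && (r \notin rook_rows C)].

Definition uncancelled C s :=
  [&& s \notin C, ~~ above_rook C s & ~~ right_of_rook C s].

Lemma nonattackingP C :
  reflect ({in C &, injective fst} /\ {in C &, injective snd}) (nonattacking C).
Proof.
apply: (iffP forall_inP) => [H|[H1 H2] s sC].
  split=> s u sC uC E; apply/eqP; move/forall_inP: (H s sC) => /(_ u uC);
    by apply: contraTT => ->; rewrite E eqxx ?andbF.
apply/forall_inP => u uC; apply/implyP => nesu.
by apply/andP; split; apply: contraNneq nesu => E; apply/eqP; [apply: H1 | apply: H2].
Qed.

Lemma card_rook_rows C : nonattacking C -> #|rook_rows C| = #|C|.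
Proof. by case/nonattackingP => inj _; apply: card_in_imset. Qed.

Lemma placements_rows_lt (p k : nat) C r : (p < n)%N ->
  C \in placements (board p) k -> r \in rook_rows C -> (r < b p)%N.
Proof.
rewrite inE => ltpn /and3P[/subsetP sC _ _] /imsetP[s /sC]; rewrite inE => /andP[lts ltb] ->.
by apply: leq_trans ltb _; apply: b_mono; rewrite ltnW.
Qed.

(** Heights increase, so every row already used meets column [p] inside the board, and [k] rooks
    block exactly [k] of its squares. *)
Lemma card_free_rows (p k : nat) C : (p < n)%N ->
  C \in placements (board p) k -> #|free_rows p C| = (b p - k)%N /\ (k <= b p)%N.
Proof.
move=> ltpn CP; have := CP; rewrite inE => /and3P[_ /eqP cC na].
pose A := [set r : 'I_m | (r < b p)%N].
have cA : #|A| = b p.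
  have -> : A = [set widen_ord (b_le ltpn) r | r : 'I_(b p)].
    apply/setP => r; rewrite inE; apply/idP/imsetP => [ltr|[r' _ ->]]; last exact: (ltn_ord r').
    by exists (Ordinal ltr) => //; apply: val_inj.
  rewrite card_imset ?card_ord // => x y E; apply: val_inj; exact: (congr1 val E).
have sA : rook_rows C \subset A.
  by apply/subsetP => r rC; rewrite inE; apply: placements_rows_lt CP rC.
have <- : #|A :\: rook_rows C| = #|free_rows p C|.
  by apply: eq_card => r; rewrite !inE andbC.
rewrite cardsD (setIidPr sA) cA card_rook_rows // cC; split=> //.
by rewrite -cA -cC -card_rook_rows // subset_leq_card.
Qed.

Lemma qrook_eq0_height (p k : nat) : (p < n)%N -> (b p < k)%N -> qrook (board p) k = 0.
Proof.
move=> ltpn ltk; rewrite /qrook big1 // => C /(card_free_rows ltpn)[_].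
by rewrite leqNgt ltk.
Qed.

Lemma qrook_eq0_width (p k : nat) : (p < k)%N -> qrook (board p) k = 0.
Proof.
move=> ltk; rewrite /qrook big1 // => C; rewrite inE => /and3P[/subsetP sC /eqP cC na].
case/nonattackingP: na => _ inj; move: ltk; rewrite -cC ltnNge; case/negP.
rewrite -(card_in_imset inj) -[p in (_ <= p)%N](size_iota 0) cardE -(size_map val).
apply: uniq_leq_size; first by rewrite map_inj_uniq ?enum_uniq //; apply: val_inj.
move=> x /mapP[y]; rewrite mem_enum => /imsetP[s /sC]; rewrite inE => /andP[lts _] -> ->.
by rewrite mem_iota.
Qed.

Lemma qrook00 : qrook (board 0) 0 = 1.
Proof.
have b0 : board 0 = set0 by apply/setP => s; rewrite !inE.
rewrite /qrook b0 (big_pred1 set0) => [|C].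
  have -> : Defs.inv set0 (set0 : {set 'I_m * 'I_n}) = 0%N by apply: eq_card0 => s; rewrite !inE.
  by [].
rewrite inE subset0 /=; case: (eqVneq C set0) => // -> /=.
rewrite cards0 eqxx /=; by apply/nonattackingP; split=> s u; rewrite inE.
Qed.

(** * Adding one column *)

Section Column.

Variable (c : 'I_n).

Lemma boardS : board c.+1 = board c :|: [set s : 'I_m * 'I_n | (s.2 == c) && (s.1 < b c)%N].
Proof.
apply/setP => s; rewrite !inE ltnS leq_eqVlt -val_eqE /=.
by case: ltngtP => [_|_|->]; rewrite ?orbF ?andbF.
Qed.

Lemma inv_boardS D : Defs.inv (board c.+1) D =
  (#|[set s in board c | uncancelled D s]|
   + #|[set x : 'I_m | (x < b c)%N && uncancelled D (x, c)]|)%N.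
Proof.
have inj : injective (fun x : 'I_m => (x, c)) by move=> x y [].
rewrite /Defs.inv -(card_imset [set x : 'I_m | _] inj) -cardsUI.
rewrite [_ :&: _](_ : _ = set0) ?cards0 ?addn0.
  apply: eq_card => -[x y]; rewrite boardS !inE /= andb_orl; congr (_ || _).
  apply/idP/imsetP => [/andP[/andP[/eqP-> lt]] Hu|[z]].
    by exists x => //; rewrite inE lt.
  by rewrite inE => /andP[lt Hu] [-> ->]; rewrite eqxx lt.
apply/setP => -[x y]; rewrite !inE; apply/negP => /andP[/andP[/andP[/= lty _] _]].
by case/imsetP => z _ [_ E]; rewrite E ltnn in lty.
Qed.

Lemma card_uncancelled_free C : C \subset board c ->
  #|[set x : 'I_m | (x < b c)%N && uncancelled C (x, c)]| = #|free_rows c C|.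
Proof.
move/subsetP => sC; apply: eq_card => x; rewrite !inE.
rewrite /uncancelled /above_rook /right_of_rook; congr (_ && _).
have colC s : s \in C -> (s.2 < c)%N by move/sC; rewrite inE => /andP[].
have -> : [exists u in C, (c == u.2) && (x < u.1)%N] = false.
  apply/idP => /exists_inP[s /colC lts /andP[/= /eqP E _]].
  by rewrite E ltnn in lts.
have -> : (x, c) \notin C by apply/negP => /colC; rewrite ltnn.
rewrite /=; congr (~~ _); apply/exists_inP/imsetP => [[s sC' /andP[/eqP E _]]|[s sC' E]].
  by exists s.
by exists s => //; rewrite colC // andbT; apply/eqP.
Qed.

Lemma inv_empty_column (k : nat) C : C \in placements (board c) k ->
  Defs.inv (board c.+1) C = (Defs.inv (board c) C + (b c - k))%N.
Proof.
move=> CP; have := CP; rewrite inE => /and3P[sC _ _].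
by rewrite inv_boardS card_uncancelled_free // (card_free_rows _ CP).1.
Qed.

(** A rook in the last column cancels nothing to its left; in its own column it leaves the free rows
    below it. *)
Lemma inv_add_rook C (r : 'I_m) : C \subset board c ->
  Defs.inv (board c.+1) ((r, c) |: C)
  = (Defs.inv (board c) C + #|[set x in free_rows c C | (r < x)%N]|)%N.
Proof.
move=> sC'; have sC := subsetP sC'.
have colC s : s \in C -> (s.2 < c)%N by move/sC; rewrite inE => /andP[].
rewrite inv_boardS; congr (_ + _)%N.
  apply: eq_card => s; rewrite !inE; case: ltnP => //= lts; congr (_ && _).
  have nesc : (s.2 == c) = false by rewrite -val_eqE /= ltn_eqF.
  rewrite /uncancelled /above_rook /right_of_rook; congr [&& ~~ _, ~~ _ & ~~ _].
  - by rewrite !inE -pair_eqE /pair_eq nesc andbF.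
  - apply/exists_inP/exists_inP => [[u]|[u uC Hu]]; last by exists u; rewrite // inE uC orbT.
    rewrite !inE => /orP[/eqP->|uC Hu]; first by rewrite nesc.
    by exists u.
  - apply/exists_inP/exists_inP => [[u]|[u uC Hu]]; last by exists u; rewrite // inE uC orbT.
    rewrite !inE => /orP[/eqP->|uC Hu]; last by exists u.
    by rewrite /= ltnNge (ltnW lts) andbF.
apply: eq_card => x; rewrite !inE /uncancelled /above_rook /right_of_rook -andbA; congr (_ && _).
have -> : [exists u in (r, c) |: C, (c == u.2) && (x < u.1)%N] = (x < r)%N.
  apply/exists_inP/idP => [[u]|lt]; last by exists (r, c); rewrite ?inE ?eqxx.
  rewrite !inE => /orP[/eqP-> /andP[]//|/colC ltu /andP[/= /eqP E _]].
  by rewrite E ltnn in ltu.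
have -> : [exists u in (r, c) |: C, (x == u.1) && (u.2 < c)%N] = (x \in rook_rows C).
  apply/exists_inP/imsetP => [[u]|[u uC E]].
    rewrite !inE => /orP[/eqP->|uC /andP[/eqP E _]]; last by exists u.
    by rewrite /= ltnn andbF.
  by exists u; rewrite ?inE ?uC ?orbT // colC // andbT; apply/eqP.
have -> : (x, c) \in (r, c) |: C = (x == r).
  rewrite !inE -pair_eqE /pair_eq /= eqxx andbT.
  case: eqP => //= _; apply/negP => /colC; by rewrite ltnn.
rewrite -leqNgt andbA andbC; congr (_ && _).
by rewrite ltn_neqAle -val_eqE eq_sym.
Qed.

Lemma placements_add_rook (k : nat) C : C \in placements (board c) k ->
  [set D in placements (board c.+1) k.+1 | D :&: board c == C]
  = [set (r, c) |: C | r in free_rows c C].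
Proof.
move=> CP; have := CP; rewrite inE => /and3P[sC /eqP cC /nonattackingP[na1 na2]].
have colC s : s \in C -> (s.2 < c)%N by move/(subsetP sC); rewrite inE => /andP[].
apply/setP => D; rewrite inE; apply/andP/imsetP => [[DP /eqP E]|[r]].
  move: DP; rewrite inE => /and3P[sD /eqP cD /nonattackingP[nd1 nd2]].
  have [[r c'] sDC] : exists s, s \in D :\: C.
    apply/card_gt0P; rewrite cardsD (setIidPr _) ?cC ?cD ?subSnn //.
    by rewrite -E subsetIl.
  move: sDC; rewrite inE => /andP[snC sD'].
  have Ec : c' = c.
    have := subsetP sD _ sD'; rewrite boardS !inE => /orP[H|/andP[/eqP//]].
    by case/negP: snC; rewrite -E inE sD' inE.
  subst c'; have ltr : (r < b c)%N.
    have := subsetP sD _ sD'; rewrite boardS !inE => /orP[|/andP[]//].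
    by rewrite /= ltnn.
  have rn : r \notin rook_rows C.
    apply/negP => /imsetP[s sC' Er]; have sD2 : s \in D by move: sC'; rewrite -E inE => /andP[].
    by move: snC; rewrite (nd1 _ _ sD' sD2 Er) sC'.
  exists r; first by rewrite inE ltr.
  apply/esym/eqP; rewrite eqEcard cardsU1 snC cC cD leqnn andbT.
  by rewrite subUset sub1set sD' -E subsetIl.
rewrite inE => /andP[ltr rn] ->.
have nC : (r, c) \notin C by apply/negP => /colC; rewrite ltnn.
split.
  rewrite inE cardsU1 nC cC eqxx boardS setUC; apply/andP; split.
    by rewrite setUSS // sub1set !inE eqxx.
  apply/nonattackingP; split=> s u; rewrite !inE => /orP[sC'|/eqP->] /orP[uC|/eqP->] //= Eq.
  - exact: na1.
  - by case/negP: rn; apply/imsetP; exists s.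
  - by case/negP: rn; apply/imsetP; exists u.
  - exact: na2.
  - by have := colC _ sC'; rewrite Eq ltnn.
  - by have := colC _ uC; rewrite -Eq ltnn.
rewrite setIUl (setIidPl sC) [X in X :|: _](_ : _ = set0) ?set0U //.
by apply/setP => s; rewrite !inE; case: eqP => // -> /=; rewrite ltnn.
Qed.

Lemma qrookS0 : qrook (board c.+1) 0 = 'X^(b c) * qrook (board c) 0.
Proof.
rewrite /qrook mulr_sumr.
have E p : placements (board p) 0 = [set set0].
  apply/setP => C; rewrite !inE cards_eq0; case: (eqVneq C set0) => [->|]; rewrite ?andbF //.
  by rewrite sub0set; apply/nonattackingP; split=> s u; rewrite inE.
rewrite !E !big_set1 (@inv_empty_column 0) ?E ?set11 // subn0 exprD mulrC.
by [].
Qed.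

(** The last column is empty or holds one rook. In the second case placements are grouped by their
    restriction [C], and the free rows of [C] add up to a q-integer by [sum_rank_qint]. *)
Lemma qrookS (k : nat) : qrook (board c.+1) k.+1
  = 'X^(b c - k.+1) * qrook (board c) k.+1 + qint (b c - k) * qrook (board c) k.
Proof.
rewrite /qrook (bigID (fun D => D \subset board c)) /=; congr (_ + _).
  rewrite mulr_sumr; apply: eq_big => [C|C /andP[CP sC]].
    rewrite !inE -!andbA; case: (boolP (C \subset board c)) => [sC|]; rewrite ?andbF //=.
    by rewrite andbT boardS (subset_trans sC) // subsetUl.
  rewrite (@inv_empty_column k.+1) ?exprD 1?mulrC //.
  by move: CP; rewrite !inE => /and3P[_ -> ->]; rewrite sC.
rewrite (partition_big (fun D => D :&: board c) (mem (placements (board c) k))) /=; last first.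
  move=> D /andP[]; rewrite !inE => /and3P[sD /eqP cD na] nsD.
  have [nd1 nd2] := nonattackingP _ na.
  rewrite subsetIr; apply/and3P; split=> //; last first.
    apply/nonattackingP; split=> s u; rewrite !inE => /andP[sD' _] /andP[uD' _].
      exact: nd1.
    exact: nd2.
  have /subsetPn[s sD' snB] := nsD.
  have colD u : u \in D -> u \notin board c -> u.2 = c.
    by move=> /(subsetP sD); rewrite boardS !inE => /orP[->//|/andP[/eqP]].
  rewrite -eqSS -cD -(cardsID (board c) D) (_ : D :\: board c = [set s]) ?cards1 ?addn1 //.
  apply/setP => u; rewrite !inE; apply/andP/eqP => [[unB uD]|->]; last first.
    by split; rewrite ?inE in snB *.
  apply: nd2 => //; rewrite (colD s) ?(colD u) //; by rewrite ?inE.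
rewrite mulr_sumr; apply: eq_bigr => C CP.
have := CP; rewrite inE => /and3P[sC /eqP cC _].
rewrite (eq_bigl (mem [set (r, c) |: C | r in free_rows c C])); last first.
  move=> D /=; rewrite -(placements_add_rook CP) !inE.
  case: (eqVneq (D :&: board c) C) => [E|_]; rewrite ?andbF // !andbT.
  case: (eqVneq #|D| k.+1) => [cD|_]; rewrite ?andbF //=.
  have -> : D \subset board c = false; last by rewrite andbT.
  by apply/negP => sD; move: cD; rewrite -(setIidPl sD) E cC => /n_Sn.
rewrite big_imset /=; last first.
  move=> r r' _ _ E; have : (r, c) \in (r', c) |: C by rewrite -E setU11.
  rewrite !inE => /orP[/eqP[]//|/(subsetP sC)]; by rewrite inE /= ltnn.
under eq_bigr do rewrite inv_add_rook // exprD.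
by rewrite -mulr_sumr sum_rank_qint (card_free_rows _ CP).1 // mulrC.
Qed.

End Column.

(** Induction on the columns, from [[b - (p - k)] + q^(b - (p - k)) [j - k] = [j + b - p]] with [b]
    the new height. *)
Lemma qrook_factor (j p : nat) : (p <= n)%N ->
  \sum_(k < p.+1) qrook (board p) (p - k) * qff j k = \prod_(i < p) qint (j + b i - i).
Proof.
elim: p => [|p IH] ltpn; first by rewrite big_ord1 big_ord0 qff0 subnn qrook00 mulr1.
rewrite [in RHS]big_ord_recr /= -IH 1?ltnW // mulr_suml.
pose c := Ordinal ltpn.
rewrite big_ord_recr /= subnn (qrookS0 c).
have -> : \sum_(k < p.+1) qrook (board p.+1) (p.+1 - k) * qff j k
  = \sum_(k < p.+1) 'X^(b p - (p.+1 - k)) * qrook (board p) (p.+1 - k) * qff j k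
    + \sum_(k < p.+1) qint (b p - (p - k)) * qrook (board p) (p - k) * qff j k.
  rewrite -big_split; apply: eq_bigr => k _ /=.
  by rewrite subSn ?(qrookS c) ?mulrDl // -ltnS.
rewrite addrAC.
(* The index is shifted by one: the term without rooks becomes the last one, and the first one
   vanishes because [p + 1] rooks do not fit in [p] columns. *)
have -> : \sum_(k < p.+1) 'X^(b p - (p.+1 - k)) * qrook (board p) (p.+1 - k) * qff j k
    + 'X^(b c) * qrook (board c) 0 * qff j p.+1
  = \sum_(k < p.+1) 'X^(b p - (p - k)) * qrook (board p) (p - k) * qff j k.+1.
  transitivity (\sum_(k < p.+2) 'X^(b p - (p.+1 - k)) * qrook (board p) (p.+1 - k) * qff j k).
    by rewrite [RHS]big_ord_recr /= subnn subn0.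
  by rewrite big_ord_recl subn0 qrook_eq0_width // mulr0 mul0r add0r.
rewrite -big_split; apply: eq_bigr => k _ /=.
have lekp : (k <= p)%N by rewrite -ltnS.
(* If [k > j] or [p - k > b p], both sides vanish; otherwise no subtraction truncates. *)
case: (leqP k j) => [lekj|ltjk]; last first.
  by rewrite !qff_small ?(ltnW ltjk) // ?(leq_trans ltjk) // !(mulr0, mul0r, addr0).
case: (leqP (p - k) (b p)) => [leb|ltb]; last first.
  by rewrite (qrook_eq0_height ltpn ltb) !(mulr0, mul0r, addr0).
have -> : (j + b p - p)%N = (b p - (p - k) + (j - k))%N by lia.
by rewrite qintD qffSr; ring.
Qed.

End Rooks.

(** * Boards made of blocks of equal columns *)

Lemma qnum_sum (n : nat) (I : finType) (F : I -> nat -> {poly int}) (m : nat) :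
  qnum n (fun j => \sum_i F i j) m = \sum_i qnum n (F i) m.
Proof.
rewrite qnum_expand; under eq_bigr do rewrite mulr_sumr.
by rewrite exchange_big; apply: eq_bigr => i _; rewrite qnum_expand.
Qed.

(** The series [sum_j qbinom j k x^j] is [x^k / prod_(i <= k) (1 - x q^i)], so its numerator is
    [x^k prod_(k < i <= n) (1 - x q^i)]; reversed in degree [n], this is the product in
    [qhit_gen]. *)
Lemma qnum_qbinom_coef (k n m : nat) : (k <= n)%N ->
  qnum n.+1 (fun j => qbinom j k) m =
    if (m <= n)%N
    then (\prod_(k.+1 <= i < n.+1) ('X - ('X^i)%:P) : {poly {poly int}})`_(n - m)
    else 0.
Proof.
move=> /subnK <-; elim: (n - k)%N m => [|e IH] m.
  rewrite add0n big_geq // coef1.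
  rewrite (@eq_qnum _ _ (fun j => qbinom (j + 0) (0 + k)) _ m) => [|j]; last by rewrite addn0.
  rewrite [LHS](qnum_qbinom_shift 0 k m).
  case: ltngtP => [H|//|->]; last by rewrite subnn.
  by move: H; rewrite -subn_gt0; case: (k - m)%N.
rewrite addSn qnumS /qdiff big_nat_recr /=; last by rewrite ltnS leq_addl.
rewrite mulrDr coefD -polyCN coefMC coefMX.
set P := \prod_(_ <= i < _) _.
case: m => [|m]; rewrite !IH.
  have szP : size P = e.+1 by rewrite size_prod_XsubC size_iota; lia.
  by rewrite !subn0 /= [P`_(e + k).+1]nth_default ?mul0r ?addr0 // szP ltnS leq_addr.
rewrite !subSS ltnS; case: (ltngtP m (e + k)) => [ltm|_|->].
- have -> : ((e + k - m)%N == 0%N) = false by lia.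
  by rewrite mulrN mulrC; congr (P`_ _ - _); lia.
- by rewrite mulr0 subr0.
- by rewrite subnn /= mulrN mulrC.
Qed.

(** * Column heights and block products *)

Lemma psum0 (a : nat -> nat) : psum a 0 = 0%N.
Proof. by rewrite /psum big_geq. Qed.

Lemma psumS (a : nat -> nat) (i : nat) : psum a i.+1 = (psum a i + a i.+1)%N.
Proof. by rewrite /psum big_nat_recr. Qed.

Lemma leq_psum (a : nat -> nat) (i j : nat) : (i <= j)%N -> (psum a i <= psum a j)%N.
Proof.
move=> /subnK <-; elim: (j - i)%N => [|e IH] //.
by rewrite addSn psumS (leq_trans IH) // leq_addr.
Qed.

Section Board.

Variables (h d : nat -> nat).

Lemma col_heights0 : col_heights 0 h d = [::].
Proof. by []. Qed.

Lemma col_heightsS (t : nat) :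
  col_heights t.+1 h d = col_heights t h d ++ nseq (d t.+1) (psum h t.+1).
Proof.
rewrite /col_heights /index_iota !subSS !subn0.
have -> : iota 1 t.+1 = iota 1 t ++ [:: t.+1] by rewrite -{1}[t.+1]addn1 iotaD add1n.
by rewrite map_cat flatten_cat /= cats0.
Qed.

Lemma size_col_heights (t : nat) : size (col_heights t h d) = psum d t.
Proof.
elim: t => [|t IH]; first by rewrite psum0.
by rewrite col_heightsS size_cat IH size_nseq psumS.
Qed.

Lemma nth_col_heightsS (t p : nat) : nth 0%N (col_heights t.+1 h d) p =
  if (p < psum d t)%N then nth 0%N (col_heights t h d) p
  else if (p < psum d t.+1)%N then psum h t.+1 else 0%N.
Proof.
rewrite col_heightsS nth_cat size_col_heights nth_nseq; case: ltnP => // lep.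
by rewrite (psumS d) ltn_subLR.
Qed.

Lemma col_heights_le (t p : nat) : (nth 0%N (col_heights t h d) p <= psum h t)%N.
Proof.
elim: t => [|t IH]; first by rewrite col_heights0 nth_nil.
rewrite nth_col_heightsS; case: ifP => _; last by case: ifP.
by rewrite (leq_trans IH) // leq_psum.
Qed.

Lemma col_heights_mono (t p q : nat) : (p <= q < psum d t)%N ->
  (nth 0%N (col_heights t h d) p <= nth 0%N (col_heights t h d) q)%N.
Proof.
elim: t => [|t IH] /andP[lepq ltq]; first by rewrite psum0 in ltq.
rewrite !nth_col_heightsS ltq (leq_ltn_trans lepq ltq).
case: (ltnP q (psum d t)) => [ltq'|leq'].
  by rewrite (leq_ltn_trans lepq ltq') IH // lepq.
by case: ifP => // _; rewrite (leq_trans (col_heights_le _ _)) // leq_psum.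
Qed.

Lemma ferrers_board (t : nat) :
  ferrers t h d = board (psum h t) (psum d t) (nth 0%N (col_heights t h d)) (psum d t).
Proof. by apply/setP => s; rewrite !inE ltn_ord. Qed.

Lemma card_ferrers (t : nat) :
  #|ferrers t h d| = (\sum_(1 <= i < t.+1) d i * psum h i)%N.
Proof.
have -> : #|ferrers t h d| = (\sum_(p < psum d t) nth 0 (col_heights t h d) p)%N.
  transitivity (\sum_(r < psum h t) \sum_(c < psum d t) (r < nth 0 (col_heights t h d) c))%N.
    rewrite pair_bigA -sum1_card big_mkcond /=; apply: eq_bigr => s _.
    by rewrite inE; case: ltnP.
  rewrite exchange_big; apply: eq_bigr => c _ /=; set b := nth _ _ _.
  rewrite -[RHS]card_ord -sum1_card.
  rewrite (big_ord_widen _ (fun=> 1%N) (col_heights_le t c)) [RHS]big_mkcond.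
  by apply: eq_bigr => r _; case: ltnP.
rewrite -(big_mkord predT (fun p => nth 0%N (col_heights t h d) p)).
rewrite -size_col_heights -(big_nth 0%N predT id).
elim: t => [|t IH]; first by rewrite col_heights0 big_nil big_geq.
rewrite col_heightsS big_cat IH [RHS]big_nat_recr //=; congr (_ + _)%N.
by rewrite big_nseq iter_addn_0 mulnC.
Qed.

Definition block_prod (t j : nat) : {poly int} :=
  \prod_(1 <= i < t.+1) qbinom (j + psum h i - psum d i.-1) (d i).

Lemma block_prod0 (j : nat) : block_prod 0 j = 1.
Proof. by rewrite /block_prod big_geq. Qed.

Lemma block_prodS (t j : nat) : block_prod t.+1 j =
  block_prod t j * qbinom (j + psum h t.+1 - psum d t) (d t.+1).
Proof. by rewrite /block_prod big_nat_recr. Qed.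

(** Column [e] of block [i], counted from 0, contributes [[j + H_i - D_(i-1) - e]]; a block thus
    gives a falling product, that is, a q-binomial times [[d_i]!]. *)
Lemma prod_columns (t j : nat) :
  \prod_(i < psum d t) qint (j + nth 0%N (col_heights t h d) i - i)
  = block_prod t j * \prod_(1 <= i < t.+1) qfact (d i).
Proof.
elim: t => [|t IH]; first by rewrite psum0 block_prod0 big_ord0 big_geq ?mulr1.
rewrite psumS big_split_ord /= block_prodS big_nat_recr //= mulrACA qbinom_fact -IH.
congr (_ * _); apply: eq_bigr => i _ /=.
  by rewrite nth_col_heightsS ltn_ord.
rewrite nth_col_heightsS ltnNge leq_addr /= psumS ltn_add2l ltn_ord.
by rewrite subnDA.
Qed.

(** [qrook_factor] expands the column product in the [qbinom j i] with coefficients [[i]! R_(n-i)];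
    [qnum_qbinom_coef] turns each into the matching term of [qhit_gen]. *)
Lemma qhit_block_prod (t k : nat) : (k <= psum d t)%N ->
  qhit (ferrers t h d) k
  = qnum (psum d t).+1 (block_prod t) (psum d t - k) * \prod_(1 <= i < t.+1) qfact (d i).
Proof.
move=> lek; set n := psum d t; rewrite mulrC -qnumZ.
rewrite (@eq_qnum _ _ (fun j =>
  \sum_(i < n.+1) (qrook (ferrers t h d) (n - i) * qfact i) * qbinom j i)).
  rewrite qnum_sum /qhit /qhit_gen coef_sum; apply: eq_bigr => i _.
  rewrite coefCM qnumZ qnum_qbinom_coef; last by rewrite -ltnS.
  rewrite leq_subr subKn //.
  by rewrite [qfact i * _]mulrC.
move=> j; rewrite mulrC -prod_columns -(@qrook_factor (psum h t) n) //.
- by apply: eq_bigr => i _; rewrite -ferrers_board -mulrA [qfact _ * _]mulrC qbinom_fact.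
- by move=> p q; apply: col_heights_mono.
- by move=> p _; apply: col_heights_le.
Qed.

Lemma qspan_prod_qfact (s : bool) (t : nat) :
  qspan s (\sum_(1 <= i < t.+1) 'C(d i, 2))%N%:Z (\prod_(1 <= i < t.+1) qfact (d i)).
Proof.
elim: t => [|t IH]; first by rewrite !big_geq //; apply: qspan1.
have -> : (\sum_(1 <= i < t.+2) 'C(d i, 2) = \sum_(1 <= i < t.+1) 'C(d i, 2) + 'C(d t.+1, 2))%N.
  by rewrite big_nat_recr.
by rewrite [\prod_(_ <= _ < _) _]big_nat_recr //= PoszD; apply: qspanM => //; apply: qspan_qfact.
Qed.

(** The darga attached to the coefficient of [x^m]; it equals [L_k] at [m = n - k]. *)
Definition board_darga (t m : nat) : int :=
  (psum d t * m)%N%:Z + (\sum_(1 <= i < t.+1) d i * psum h i)%N%:Z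
    - (\sum_(1 <= i < t.+1) psum d i * d i)%N%:Z.

Lemma board_darga0 (m : nat) : board_darga 0 m = 0.
Proof. by rewrite /board_darga psum0 !big_geq. Qed.

Lemma board_dargaS (t m : nat) : board_darga t.+1 m =
  board_darga t m + (d t.+1 * m)%N%:Z + (d t.+1 * psum h t.+1)%N%:Z
    - ((psum d t + d t.+1) * d t.+1)%N%:Z.
Proof.
have recr F : (\sum_(1 <= i < t.+2) F i = \sum_(1 <= i < t.+1) F i + F t.+1)%N.
  by rewrite big_nat_recr.
rewrite /board_darga !recr !(psumS d); lia.
Qed.

(** The [i]-th factor has darga [d_i (j + H_i - D_i)] unless it vanishes. *)
Lemma qspan_block_prod (s : bool) (t j : nat) : (forall i, (1 <= i <= t)%N -> (0 < d i)%N) ->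
  qspan s (board_darga t j) (block_prod t j).
Proof.
elim: t => [|t IH] d0; first by rewrite block_prod0 board_darga0; apply: qspan1.
have {}IH := IH (fun i Hi => d0 i ltac:(lia)).
rewrite block_prodS board_dargaS.
case: (leqP (d t.+1) (j + psum h t.+1 - psum d t)) => [le|lt]; last first.
  by rewrite (qbinom_small lt) mulr0; apply: qspan0.
have := qspanM IH (@qspan_qbinom s _ _ le); congr (qspan _ _ _).
have d1 := d0 t.+1 ltac:(lia).
have [e He] : exists e, (j + psum h t.+1 = psum d t + d t.+1 + e)%N.
  by exists (j + psum h t.+1 - psum d t - d t.+1)%N; lia.
have -> : (j + psum h t.+1 - psum d t - d t.+1 = e)%N by lia.
have := congr1 (muln (d t.+1)) He; lia.
Qed.

(** In [qnum_expand] the term [r] has darga [r (r - 1) + r (n + 1 - r) = r n] plus that of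
    [block_prod t (m - r)], which is lower by [r n] than at [m]; so all terms share one darga. *)
Lemma qspan_qnum_block_prod (t m : nat) : (forall i, (1 <= i <= t)%N -> (0 < d i)%N) ->
  qspan true (board_darga t m) (qnum (psum d t).+1 (block_prod t) m).
Proof.
move=> d0; rewrite qnum_expand; apply: qspan_sum => -[r /= ltr] _.
case: (leqP r (psum d t).+1) => [ler|ltr']; last first.
  by rewrite (qbinom_small ltr') mulr0 mul0r; apply: qspan0.
have sgn l g : qspan true l g -> qspan true l ((-1) ^+ r * g).
  move=> Hg; elim: r {ltr ler} => [|r IHr]; first by rewrite expr0 mul1r.
  by rewrite exprS -mulrA mulN1r; apply: qspanN.
rewrite -!mulrA; apply: sgn.
have := qspanXM 'C(r, 2) (qspanM (qspan_qbinom true ler) (qspan_block_prod true (m - r) d0)).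
congr (qspan _ _ _); rewrite /board_darga.
have [e Em] : exists e, m = (r + e)%N by exists (m - r)%N; lia.
have [w Ew] : exists w, (psum d t).+1 = (r + w)%N by exists ((psum d t).+1 - r)%N; lia.
have := mul_bin_diag r 1; rewrite bin1 Em Ew !addKn.
case: r Ew {ltr ler Em} => [|r] /= Ew; first by lia.
have -> : psum d t = (r + w)%N by lia.
lia.
Qed.

(* The bounds on [m] keep the upper arguments of the two q-binomials of
   [qnum_qbinom_mul] nonnegative when the next block is added. *)
Lemma qspan_false_qnum_block_prod (t : nat) : d 0%N = 0%N ->
    (forall i, (1 <= i <= t)%N -> (h i <= d i.-1 + d i)%N) \/
    (forall i, (1 <= i <= t)%N -> (psum h i <= psum d i)%N) ->
  forall m, let f := qnum (psum d t).+1 (block_prod t) m in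
    qspan false (board_darga t m) f /\
    (f != 0 -> [/\ psum d t <= m + psum h t, m + psum h t <= psum d t + psum d t.-1
                & m <= psum d t]%N).
Proof.
move=> d0; elim: t => [|t IH] Hcond m f.
  have -> : f = (m == 0)%N%:R.
    rewrite /f psum0 -(qnum_qbinom 0 m); apply: eq_qnum => j.
    by rewrite block_prod0 qbinom0.
  rewrite board_darga0 !psum0; case: eqP => [->|_] /=; last by split; [apply: qspan0|rewrite eqxx].
  by split=> //; apply: qspan1.
have /IH {}IH : (forall i, (1 <= i <= t)%N -> (h i <= d i.-1 + d i)%N) \/
    (forall i, (1 <= i <= t)%N -> (psum h i <= psum d i)%N).
  by case: Hcond => H; [left | right] => i Hi; apply: H; lia.
have HD : psum d t = (psum d t.-1 + d t)%N.
  by case: (t) => [|t'] /=; rewrite ?psumS // psum0 d0.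
pose g := qnum (psum d t).+1 (block_prod t).
have HS := psumS h t; have DS := psumS d t.
(* For the upper bound, the first case adds [h_(t+1) <= d_t + d_(t+1)] to
   [i + H_t <= D_t + D_(t-1)]; the second adds [H_(t+1) <= D_(t+1)] to [i <= D_t]. *)
have al_le i : g i != 0 -> (psum d t <= i + psum h t.+1 <= psum d t + psum d t.+1)%N.
  move=> /((IH i).2)[h1 h2 h3].
  by case: Hcond => H; have := H t.+1 ltac:(lia); rewrite /=; lia.
(* The old block product is rebuilt from its numerator [g]; extracting [x^i] replaces [j] by [j + i]
   in the new factor. *)
have fE : f = \sum_(i < m.+1) g i *
    qnum (psum d t.+1).+1 (fun j => qbinom (j + psum d t) (psum d t)
       * qbinom (j + i + psum h t.+1 - psum d t) (d t.+1)) (m - i).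
  rewrite /f -(qnum_conv _ g (fun i j => qbinom (j + psum d t) (psum d t)
    * qbinom (j + i + psum h t.+1 - psum d t) (d t.+1))).
  apply: eq_qnum => j; rewrite block_prodS (qnumK (psum d t) (block_prod t) j).
  rewrite mulr_suml; apply: eq_bigr => -[i /= lti] _.
  by rewrite -mulrA; congr (_ * (_ * qbinom (_ - _) _)); lia.
pose al i := (i + psum h t.+1 - psum d t)%N.
have {}fE : f = \sum_(i < m.+1) g i * (if (m - i <= d t.+1)%N then
     'X^((m - i) * (al i - (d t.+1 - (m - i)))) * qbinom (al i) (d t.+1 - (m - i))
       * qbinom (psum d t + d t.+1 - al i) (m - i) else 0).
  rewrite fE; apply: eq_bigr => -[i /= lti] _.
  have [->|gi0] := eqVneq (g i) 0; first by rewrite !mul0r.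
  congr (_ * _); rewrite DS -qnum_qbinom_mul; last by have := al_le i gi0; rewrite /al; lia.
  apply: eq_qnum => j; congr (_ * qbinom _ _); have := al_le i gi0; rewrite /al; lia.
split.
  rewrite fE; apply: qspan_sum => -[i /= lti] _.
  have [->|gi0] := eqVneq (g i) 0; first by rewrite !mul0r; apply: qspan0.
  case: leqP => [ler|_]; last by rewrite mulr0; apply: qspan0.
  case: (leqP (d t.+1 - (m - i)) (al i)) => [le1|lt1]; last first.
    by rewrite (qbinom_small lt1) mulr0 mul0r mulr0; apply: qspan0.
  case: (leqP (m - i) (psum d t + d t.+1 - al i)) => [le2|lt2]; last first.
    by rewrite (qbinom_small lt2) !mulr0; apply: qspan0.
  rewrite -(mulrA 'X^_).
  have := qspanM (IH i).1 (qspanXM ((m - i) * (al i - (d t.+1 - (m - i))))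
    (qspanM (qspan_qbinom false le1) (qspan_qbinom false le2))).
  congr (qspan _ _ _); rewrite board_dargaS /board_darga.
  have := al_le i gi0; rewrite /al in le1 le2 *; move: le1 le2 ler; rewrite DS.
  move: (psum h t.+1) (psum d t) (d t.+1) => H D e le1 le2 ler leal.
  (* Fresh names for the differences leave no truncated subtraction in the darga identity. *)
  have [r Er] : exists r, m = (i + r)%N by exists (m - i)%N; lia.
  subst m; move: le1 le2 ler; rewrite addKn => le1 le2 ler.
  have [p Ep] : exists p, e = (r + p)%N by exists (e - r)%N; lia.
  subst e; move: le1 le2 leal; rewrite addKn => le1 le2 leal.
  have [u Eu] : exists u, (i + H = D + p + u)%N by exists (i + H - D - p)%N; lia.
  have -> : (i + H - D - p)%N = u by lia.
  have -> : (i + H - D)%N = (p + u)%N by lia.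
  have [w Ew] : exists w, D = (u + w)%N by exists (D - u)%N; lia.
  have -> : (D + (r + p) - (p + u))%N = (r + w)%N by lia.
  have := congr1 (muln (r + p)) Eu; rewrite Ew addKn; lia.
move=> f0; have [i Hi] : exists i : 'I_m.+1, g i * (if (m - i <= d t.+1)%N then
     'X^((m - i) * (al i - (d t.+1 - (m - i)))) * qbinom (al i) (d t.+1 - (m - i))
       * qbinom (psum d t + d t.+1 - al i) (m - i) else 0) != 0.
  apply/existsP; apply: contraNT f0; rewrite negb_exists => /forallP H.
  by rewrite fE; apply/eqP; apply: big1 => i _; apply/eqP; rewrite -[_ == _]negbK.
move: Hi; rewrite mulf_eq0 negb_or => /andP[gi0].
case: leqP => [ler|_]; last by rewrite eqxx.
case: (leqP (d t.+1 - (m - i)) (al i)) => [le1|lt1]; last first.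
  by rewrite (qbinom_small lt1) mulr0 mul0r eqxx.
case: (leqP (m - i) (psum d t + d t.+1 - al i)) => [le2|lt2]; last first.
  by rewrite (qbinom_small lt2) mulr0 eqxx.
(* The two nonzero q-binomials give the first two bounds for [t + 1]; [m - i <= d_(t+1)] and
   [i <= D_t] give the third. *)
move=> _; have [h1 h2 h3] := (IH i).2 gi0; have := al_le i gi0; have := ltn_ord i.
by rewrite /al in le1 le2 * => /=; split; lia.
Qed.

End Board.

(** The product of the [[d_i]!] has darga [sum_i C(d_i, 2)], by which [T_k] is shifted relative to
    the quotient. *)
Theorem theorem7 (t : nat) (h d : nat -> nat) (k : nat)
    (t_ge1 : (1 <= t)%N)
    (d0 : d 0%N = 0%N)
    (d_gt0 : forall i : nat, (1 <= i <= t)%N -> (0 < d i)%N)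
    (le_kn : (k <= psum d t)%N) :
  zero_or_symmetric
    (Ldarga t h d k + (\sum_(1 <= i < t.+1) 'C(d i, 2))%N%:Z)
    (qhit (ferrers t h d) k)
  /\
  exists f : {poly int},
    [/\ qhit (ferrers t h d) k = f * \prod_(1 <= i < t.+1) qfact (d i),
        zero_or_symmetric (Ldarga t h d k) f
      & (forall i : nat, (1 <= i <= t)%N -> (h i <= d i.-1 + d i)%N) \/
        (forall i : nat, (1 <= i <= t)%N -> (psum h i <= psum d i)%N) ->
        zsu (Ldarga t h d k) f].
Proof.
have LE : Ldarga t h d k = board_darga h d t (psum d t - k).
  by rewrite /Ldarga /board_darga card_ferrers; lia.
have Hs := qspan_qnum_block_prod h (psum d t - k) d_gt0.
rewrite qhit_block_prod // LE; split.
  apply: (@qspan_zero_or_symmetric true); apply: qspanM => //.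
  exact: qspan_prod_qfact.
exists (qnum (psum d t).+1 (block_prod h d t) (psum d t - k)); split=> // [|Hc].
  exact: qspan_zero_or_symmetric Hs.
exact: qspan_zsu (qspan_false_qnum_block_prod d0 Hc _).1.
Qed.
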